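(* Let $d>1$ be an integer and let $G$ be a finite, undirected, connected graph such that the homshift $X^d_G$ is topologically mixing. Then the following three conditions are equivalent: (1) $X^d_G$ is cohomologically trivial; (2) the square group $\pi_1^{\square}(G)$ of $G$ is isomorphic to $\mathbb{Z}/2\mathbb{Z}$; (3) the even square group $\mathcal{E}_G^{\square}$ of $G$ is trivial.
   Context: Graphs: a graph $G$ has vertex set $V_G$ and edge set $E_G\subset V_G\times V_G$; it is undirected if $E_G$ is symmetric; self-loops $(v,v)$ are allowed. Homshift: $X^d_G$ is the set of graph homomorphisms from $\mathbb{Z}^d$ (Cayley graph with standard generators) to $G$, i.e. of $x\in V_G^{\mathbb{Z}^d}$ with $(x_{\mathbf i},x_{\mathbf j})\in E_G$ whenever $|\mathbf i-\mathbf j|_1=1$. It carries the topology induced by the product topology ($V_G$ discrete) and the shift action $(\sigma^{\mathbf i}(x))_{\mathbf j}=x_{\mathbf i+\mathbf j}$. It is topologically mixing if it is nonempty and for all nonempty open $U,V\subset X^d_G$ one has $U\cap\sigma^{\mathbf n}(V)\neq\emptyset$ for all $\mathbf n\in\mathbb{Z}^d$ with $|\mathbf n|_1$ large enough. Cohomology: let $X$ be a $d$-dimensional subshift (closed shift-invariant subset of $\mathcal{A}^{\mathbb{Z}^d}$, $\mathcal{A}$ finite). A cocycle on $X$ with values in a discrete group $\mathbb{G}$ is a map $c:\mathbb{Z}^d\times X\to\mathbb{G}$ with $c(\mathbf m+\mathbf n,z)=c(\mathbf m,\sigma^{\mathbf n}(z))\,c(\mathbf n,z)$ for all $\mathbf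 m,\mathbf n\in\mathbb{Z}^d$, $z\in X$. It is continuous if each $c(\mathbf n,\cdot)$ is continuous. It is a group homomorphism if $c(\mathbf n,\cdot)$ is constant for every $\mathbf n$. Cocycles $c,c':\mathbb{Z}^d\times X\to\mathbb{G}$ are (continuously) cohomologous if there is a continuous $b:X\to\mathbb{G}$ with $c(\mathbf n,z)=b(\sigma^{\mathbf n}(z))^{-1}c'(\mathbf n,z)b(z)$ for all $\mathbf n,z$. A cocycle is trivial if it is cohomologous to a group homomorphism. $X$ is cohomologically trivial if all its continuous cocycles (with values in arbitrary discrete groups) are trivial. Square groups: a walk is a word $p=p_0\cdots p_n$ of vertices with $(p_i,p_{i+1})\in E_G$; its length is $l(p)=n$; it is a cycle if $p_n=p_0$. A backtrack is a cycle $aba$ of length two ($a=b$ allowed if there is a loop at $a$). A walk is non-backtracking if it contains no backtrack ($p_i\ne p_{i+2}$ for all $i$). A square is a non-backtracking cycle of length four. For a walk $p$, $\varphi(p)$ is the non-backtracking walk obtained by successively replacing backtracks $aba$ by $a$ (the result does not depend on the order). $p\odot q=p_0\cdots p_{l(p)}q_1\cdots q_{l(q)}$ when $p_{l(p)}=q_0$, $p\star q=\varphi(p\odot q)$, and $p^{-1}$ is the reversed walk. For $a\in V_G$, $\pi_1(G)[a]$ is the group (under $\star$) of non-backtracking cycles beginning at $a$; $\Delta(G)[a]$ is its smallest normal subgroup containing all $p\star s\star p^{-1}$ with $s$ a square and $p$ a walk from $a$ to $s_0$; $\mathcal{E}_G[a]\supset\Delta(G)[a]$ is the subgroup of cycles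 of even length. The square group is $\pi_1^{\square}(G)[a]=\pi_1(G)[a]/\Delta(G)[a]$ and the even square group is $\mathcal{E}_G^{\square}[a]=\mathcal{E}_G[a]/\Delta(G)[a]$; up to isomorphism they do not depend on $a$ and are denoted $\pi_1^{\square}(G)$ and $\mathcal{E}_G^{\square}$. *)

(* Defs.v *)
From HB Require Import structures.
From mathcomp Require Import all_boot all_order all_algebra.
From mathcomp Require Import boolp classical_sets topology.

Import GRing.Theory.

Set Implicit Arguments.
Unset Strict Implicit.
Unset Printing Implicit Defensive.

Section Normal.
Local Open Scope group_scope.
Variable H : groupType.

Definition is_normal_subgroup (N : set H) : Prop :=
  [/\ N 1, forall x y, N x -> N y -> N (x * y), forall x, N x -> N x^-1
    & forall x y, N x -> N (x ^ y)].

Record normal_subgroup := NormalSubgroup {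
  normal_set : set H;
  normalP : is_normal_subgroup normal_set }.

Lemma smallest_normalP (S : set H) :
  is_normal_subgroup (smallest is_normal_subgroup S).
Proof.
split=> [N [[]]//|x y Nx Ny N NN|x Nx N NN|x y Nx N NN].
- by case: (NN) => [[_ + _ _] _]; apply; [apply: Nx|apply: Ny].
- by case: (NN) => [[_ _ + _] _]; apply; apply: Nx.
- by case: (NN) => [[_ _ _ +] _]; apply; apply: Nx.
Qed.

Definition normal_closure (S : set H) : normal_subgroup :=
  NormalSubgroup (smallest_normalP S).

Variable N : normal_subgroup.

Definition coset_eq (x y : H) : bool := `[< normal_set N (x^-1 * y) >].

Lemma coset_eqP : equiv_class_of coset_eq.
Proof.
have [N1 NM NV _] := normalP N.
split=> [x|x y|y x z]; first by apply/asboolP; rewrite mulVg.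
- by apply/asboolP/asboolP => /NV; rewrite invgM invgK.
- by move=> /asboolP xy /asboolP yz; apply/asboolP;
    have := NM _ _ xy yz; rewrite -mulgA mulVKg.
Qed.

Canonical coset_equiv := EquivRelPack coset_eqP.
Canonical coset_encModRel := defaultEncModRel coset_eq.

Local Open Scope quotient_scope.

Definition quotient_group := {eq_quot coset_eq}.

HB.instance Definition _ : EqQuotient H coset_eq quotient_group :=
  EqQuotient.on quotient_group.
HB.instance Definition _ := Choice.on quotient_group.

Lemma quotient_eqP (x y : H) :
  reflect (normal_set N (x^-1 * y)) (\pi_quotient_group x == \pi_quotient_group y).
Proof. by rewrite piE; apply: asboolP. Qed.

Definition quotient_mul := lift_op2 quotient_group *%g.
Definition quotient_inv := lift_op1 quotient_group (fun x : H => x^-1).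
Definition quotient_one : quotient_group := \pi_quotient_group 1.

Lemma pi_quotient_mul :
  {morph \pi_quotient_group : x y / x * y >-> quotient_mul x y}.
Proof.
move=> x y; unlock quotient_mul; apply/eqP/quotient_eqP.
have [_ NM _ NJ] := normalP N.
set x' := repr _; set y' := repr _.
have Nx : normal_set N (x^-1 * x') by apply/quotient_eqP; rewrite reprK.
have Ny : normal_set N (y^-1 * y') by apply/quotient_eqP; rewrite reprK.
suff -> : (x * y)^-1 * (x' * y') = (x^-1 * x') ^ y * (y^-1 * y').
  by apply: NM => //; apply: NJ.
by rewrite /conjg invgM !mulgA mulgK.
Qed.

Lemma pi_quotient_inv :
  {morph \pi_quotient_group : x / x^-1 >-> quotient_inv x}.
Proof.
move=> x; unlock quotient_inv; apply/eqP/quotient_eqP.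
have [_ _ NV NJ] := normalP N; set x' := repr _.
have /NV/(NJ _ x^-1) : normal_set N (x^-1 * x') by apply/quotient_eqP; rewrite reprK.
by rewrite /conjg invgM !invgK !mulgA mulgK.
Qed.

Lemma quotient_mulA : associative quotient_mul.
Proof.
move=> x y z; rewrite -[x]reprK -[y]reprK -[z]reprK.
by rewrite -!pi_quotient_mul mulgA.
Qed.

Lemma quotient_mul1 : left_id quotient_one quotient_mul.
Proof. by move=> x; rewrite -[x]reprK -pi_quotient_mul mul1g. Qed.

Lemma quotient_mulr1 : right_id quotient_one quotient_mul.
Proof. by move=> x; rewrite -[x]reprK -pi_quotient_mul mulg1. Qed.

Lemma quotient_mulV : left_inverse quotient_one quotient_inv quotient_mul.
Proof.
by move=> x; rewrite -[x]reprK -pi_quotient_inv -pi_quotient_mul mulVg.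
Qed.

Lemma quotient_mulrV : right_inverse quotient_one quotient_inv quotient_mul.
Proof.
by move=> x; rewrite -[x]reprK -pi_quotient_inv -pi_quotient_mul mulgV.
Qed.

HB.instance Definition _ := isGroup.Build quotient_group
  quotient_mulA quotient_mul1 quotient_mulr1 quotient_mulV quotient_mulrV.

End Normal.

Definition isomorphic (H K : groupType) : Prop :=
  exists f : {multiplicative H -> K}, bijective f.

Definition trivial_group (H : groupType) : Prop := forall x : H, x = 1%g.

(** Self-loops are allowed: [edge] need not be irreflexive. *)
Record ugraph := UGraph {
  vertex :> finType;
  edge : rel vertex;
  edge_sym : symmetric edge }.

Arguments edge {u}.

Definition graph_connected (G : ugraph) : Prop :=
  forall x y : G, connect edge x y.

Section Words.
Variable T : eqType.
Implicit Types (x y a b : T) (p q s t : seq T).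

(** A walk [p_0 ... p_n] is represented by the nonempty sequence of its [n.+1]
    vertices, hence the shift by one between its length and its size. *)

Definition walk_length s := (size s).-1.

Fixpoint nonbacktracking s : bool :=
  if s is x :: s' then
    (if s' is _ :: z :: _ then x != z else true) && nonbacktracking s'
  else true.

(** [reduce] erases the backtracks [a b a] (replaced by [a]) from right to left.
    [reduce_backtrack], [reduce_nonbacktracking] and [reduce_id] show that erasing
    them in any order gives the same result. *)

Definition push x s :=
  if s is y :: (z :: _) as s' then
    if z == x then s' else x :: s
  else x :: s.

Definition reduce s := foldr push [::] s.

Definition odot p q := p ++ behead q.

Definition star p q := reduce (odot p q).

Lemma push_nonbacktracking x s :
  nonbacktracking s -> nonbacktracking (push x s).
Proof.
case: s => [|y [|z s]] //= ns; case: eqP ns => [_ /andP[_]//|zx ns] /=.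
by rewrite ns eq_sym; move/eqP: zx => ->.
Qed.

Lemma reduce_nonbacktracking s : nonbacktracking (reduce s).
Proof. by elim: s => //= x s; apply: push_nonbacktracking. Qed.

Lemma reduce_id s : nonbacktracking s -> reduce s = s.
Proof.
elim: s => //= x s IHs /andP[xs ns]; rewrite IHs //.
by case: s xs {IHs ns} => [|y [|z s]] //=; rewrite eq_sym => /negPf->.
Qed.

Lemma push_head x s : exists s', push x s = x :: s'.
Proof.
case: s => [|y [|z s]] /=; try by eexists.
by case: eqP => [->|_]; eexists.
Qed.

Lemma pushK x y s : nonbacktracking (x :: s) ->
  push x (push y (x :: s)) = x :: s.
Proof.
case: s => [|z s] /=; first by rewrite eqxx.
case: eqP => [->|_ _] /=; last by rewrite eqxx.
by case: s => [|t s] //= /andP[xt _]; rewrite eq_sym (negPf xt).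
Qed.

Lemma reduce_cat s t : reduce (s ++ t) = foldr push (reduce t) s.
Proof. by rewrite /reduce foldr_cat. Qed.

Lemma reduce_catr s t : reduce (s ++ reduce t) = reduce (s ++ t).
Proof. by rewrite !reduce_cat (reduce_id (reduce_nonbacktracking t)). Qed.

Lemma reduce_backtrack s a b t :
  reduce (s ++ [:: a, b, a & t]) = reduce (s ++ a :: t).
Proof.
rewrite !reduce_cat /=; congr foldr; have [u us] := push_head a (reduce t).
have := push_nonbacktracking a (reduce_nonbacktracking t).
by rewrite us; apply: pushK.
Qed.

Lemma reduce_head x s : exists s', reduce (x :: s) = x :: s'.
Proof. exact: push_head. Qed.

Lemma push_last x y s : last x (push y s) = last y s.
Proof. by case: s => [|z [|t s]] //=; case: eqP. Qed.

Lemma reduce_last x s : last x (reduce s) = last x s.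
Proof.
elim: s x => //= y s IHs x; rewrite push_last.
by case: s IHs => [|z s] // IHs; rewrite IHs.
Qed.

Lemma odd_size_reduce s : odd (size (reduce s)) = odd (size s).
Proof.
elim: s => //= x s <-.
by case: (reduce s) => [|y [|z t]] //=; case: eqP => //=; rewrite !negbK.
Qed.

Lemma odotE p x q : odot (rcons p x) (x :: q) = p ++ x :: q.
Proof. by rewrite /odot /= cat_rcons. Qed.

Lemma reduce_odotl p x q :
  reduce (odot (reduce (rcons p x)) (x :: q)) = reduce (p ++ x :: q).
Proof.
elim: p => [|y p IHp] /=; first by [].
case rE: (reduce (rcons p x)) IHp => [|z [|t r]] IHp /=.
- have [t] : exists t, reduce (rcons p x) = head x p :: t.
    by case: (p) => [|y' p'] /=; [exists [::]|apply: reduce_head].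
  by rewrite rE.
- have := reduce_last x (rcons p x); rewrite rE last_rcons /= => zx.
  by move: IHp; rewrite zx /odot /= => <-.
case: eqP IHp => [->|_] <- //=.
have [u us] := reduce_head y (r ++ q).
have := reduce_nonbacktracking (y :: r ++ q).
by rewrite us => nu; move: us; rewrite /odot /= => ->; rewrite pushK.
Qed.

Lemma star_reducel p x q :
  star (reduce (rcons p x)) (x :: q) = star (rcons p x) (x :: q).
Proof. by rewrite /star reduce_odotl odotE. Qed.

Lemma star_reducer p x q :
  star (rcons p x) (reduce (x :: q)) = star (rcons p x) (x :: q).
Proof.
have [t qt] := reduce_head x q.
by rewrite /star qt odotE -qt reduce_catr odotE.
Qed.

Lemma nonbacktrackingP x0 s :
  reflect (forall i, i.+2 < size s -> nth x0 s i != nth x0 s i.+2)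
          (nonbacktracking s).
Proof.
apply: (iffP idP) => [|].
  elim: s => // x s IHs /= /andP[xs /IHs nsP] [|i]; last exact: nsP.
  by case: s xs {IHs nsP} => [|y [|z s]].
elim: s => // x s IHs nsP /=; rewrite IHs ?andbT => [|i]; last exact: (nsP i.+1).
by case: s nsP {IHs} => [|y [|z s]] // /(_ 0); apply.
Qed.

Lemma nonbacktracking_rev s : nonbacktracking (rev s) = nonbacktracking s.
Proof.
suff imp t : nonbacktracking t -> nonbacktracking (rev t).
  by apply/idP/idP => [/imp|/imp//]; rewrite revK.
case: t => // x0 t' /(nonbacktrackingP x0); move: (x0 :: t') => t ntP.
apply/(nonbacktrackingP x0) => i; rewrite size_rev => it.
rewrite !nth_rev ?(ltnW (ltnW it)) ?(ltnW it) // eq_sym.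
have ti := subnK it; set k := (size t - i.+3)%N in ti *.
have -> : size t - i.+1 = k.+2 by rewrite -ti -[i.+3]/(2 + i.+1) addnA addnK addn2.
by apply: ntP; rewrite -ti !addnS !ltnS leq_addr.
Qed.

End Words.

Section SquareGroup.
Variable G : ugraph.
Implicit Types (a b c : G) (p q s : seq G).

(** [walk a b s]: [s] is a walk from [a] to [b]. *)
Definition walk a b s : bool :=
  if s is x :: p then [&& x == a, path edge x p & last x p == b] else false.

Definition square b s : bool :=
  [&& walk b b s, nonbacktracking s & walk_length s == 4].

Lemma walkP a b s :
  reflect (exists p, [/\ s = a :: p, path edge a p & last a p = b]) (walk a b s).
Proof.
apply: (iffP idP) => [|[p [-> pP lP]]]; last by rewrite /= eqxx pP lP eqxx.
by case: s => //= x p /and3P[/eqP-> pP /eqP lP]; exists p.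
Qed.

Lemma walk_odot a b c p q : walk a b p -> walk b c q -> walk a c (odot p q).
Proof.
move=> /walkP[p' [-> pP lP]] /walkP[q' [-> qP lQ]]; apply/walkP.
by exists (p' ++ q'); rewrite cat_path pP last_cat lP.
Qed.

Lemma walk_push a b c s : edge a b -> walk b c s -> walk a c (push a s).
Proof.
move=> ab /walkP[[|x p] [-> /= pP lP]] /=; first by rewrite eqxx ab lP eqxx.
case/andP: pP => bx xP; case: eqP => [<-|_] /=; first by rewrite eqxx xP lP eqxx.
by rewrite eqxx ab bx xP lP eqxx.
Qed.

Lemma walk_reduce a b s : walk a b s -> walk a b (reduce s).
Proof.
move=> /walkP[p [-> pP lP]]; elim: p a pP lP => /= [|x p IHp] a.
  by move=> _ ->; rewrite eqxx.
by move=> /andP[ax xP] lP; apply: walk_push ax _; apply: IHp.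
Qed.

Lemma walk_star a b c p q : walk a b p -> walk b c q -> walk a c (star p q).
Proof. by move=> wp wq; apply/walk_reduce/(walk_odot wp). Qed.

Lemma walk_rev a b s : walk a b s -> walk b a (rev s).
Proof.
move=> /walkP[p [-> pP lP]]; rewrite lastI rev_rcons lP /= eqxx /=.
have -> : path edge b (rev (belast a p)).
  by rewrite -lP rev_path -(eq_path (@edge_sym G)).
by case: p {pP} lP => [|x p] /= => [->|_]; rewrite ?rev_cons ?last_rcons eqxx.
Qed.

Lemma starA a b c d p q s : walk a b p -> walk b c q -> walk c d s ->
  star p (star q s) = star (star p q) s.
Proof.
move=> /walkP[p' [-> _ lP]] /walkP[q' [-> _ lQ]] /walkP[s' [-> _ _]].
have pE : a :: p' = rcons (belast a p') b by rewrite lastI lP.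
have pqE : odot (a :: p') (b :: q') = rcons (belast a (p' ++ q')) c.
  by rewrite /odot /= lastI last_cat lP lQ.
have -> : star (b :: q') (c :: s') = reduce (b :: (q' ++ s')) by [].
have -> : star (a :: p') (b :: q') = reduce (rcons (belast a (p' ++ q')) c).
  by rewrite -pqE.
by rewrite star_reducel -pqE pE star_reducer -pE /star /odot /= catA.
Qed.

Lemma star1 a b s : walk a b s -> nonbacktracking s -> star [:: a] s = s.
Proof. by move=> /walkP[p [-> _ _]]; apply: reduce_id. Qed.

Lemma starr1 b s : nonbacktracking s -> star s [:: b] = s.
Proof. by move=> ns; rewrite /star /odot cats0 reduce_id. Qed.

Lemma star_revl a b s : walk a b s -> star (rev s) s = [:: b].
Proof.
move=> /walkP[p [-> _]]; elim: p a => [|x p IHp] a => [/= -> //|lP].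
rewrite /star /odot [behead _]/= !rev_cons -!cats1 -!catA reduce_backtrack.
by rewrite -(IHp x lP) /star /odot rev_cons -cats1 -catA.
Qed.

Lemma star_revr a b s : walk a b s -> star s (rev s) = [:: a].
Proof. by move=> /walk_rev/star_revl; rewrite revK. Qed.

Lemma odd_walk_length_star a b c p q : walk a b p -> walk b c q ->
  odd (walk_length (star p q)) = odd (walk_length p) (+) odd (walk_length q).
Proof.
move=> wp wq; have := walk_star wp wq; have := odd_size_reduce (odot p q).
move/walkP: wp => [p' [-> _ _]]; move/walkP: wq => [q' [-> _ _]].
rewrite -/(star _ _) /walk_length /odot /= size_cat.
by case: (star _ _) => //= x t /negb_inj; rewrite oddD.
Qed.

Variable a : G.

Definition reduced_cycle s : bool := walk a a s && nonbacktracking s.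

Record pi1 : Type := Pi1 { pi1_walk : seq G; _ : reduced_cycle pi1_walk }.

HB.instance Definition _ := [isSub for pi1_walk].
HB.instance Definition _ := [Choice of pi1 by <:].

Implicit Types g h k : pi1.

Lemma pi1_isWalk g : walk a a (pi1_walk g).
Proof. by case: g => s /= /andP[]. Qed.

Lemma pi1_nonbacktracking g : nonbacktracking (pi1_walk g).
Proof. by case: g => s /= /andP[]. Qed.

Lemma pi1_mul_subproof g h : reduced_cycle (star (pi1_walk g) (pi1_walk h)).
Proof.
rewrite /reduced_cycle (walk_star (pi1_isWalk g) (pi1_isWalk h)) /=.
exact: reduce_nonbacktracking.
Qed.

Lemma pi1_one_subproof : reduced_cycle [:: a].
Proof. by rewrite /reduced_cycle /= eqxx. Qed.

Lemma pi1_inv_subproof g : reduced_cycle (rev (pi1_walk g)).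
Proof.
by rewrite /reduced_cycle walk_rev ?pi1_isWalk // nonbacktracking_rev
  pi1_nonbacktracking.
Qed.

Definition pi1_mul g h : pi1 := Pi1 (pi1_mul_subproof g h).
Definition pi1_one : pi1 := Pi1 pi1_one_subproof.
Definition pi1_inv g : pi1 := Pi1 (pi1_inv_subproof g).

Lemma pi1_mulA : associative pi1_mul.
Proof.
by move=> g h k; apply/val_inj; apply: starA; apply: pi1_isWalk.
Qed.

Lemma pi1_mul1 : left_id pi1_one pi1_mul.
Proof.
move=> g; apply/val_inj.
exact: star1 (pi1_isWalk g) (pi1_nonbacktracking g).
Qed.

Lemma pi1_mulr1 : right_id pi1_one pi1_mul.
Proof. by move=> g; apply/val_inj/starr1/pi1_nonbacktracking. Qed.

Lemma pi1_mulV : left_inverse pi1_one pi1_inv pi1_mul.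
Proof. by move=> g; apply/val_inj/star_revl/pi1_isWalk. Qed.

Lemma pi1_mulrV : right_inverse pi1_one pi1_inv pi1_mul.
Proof. by move=> g; apply/val_inj/star_revr/pi1_isWalk. Qed.

HB.instance Definition _ := isGroup.Build pi1
  pi1_mulA pi1_mul1 pi1_mulr1 pi1_mulV pi1_mulrV.

Definition even_pred : {pred pi1} :=
  fun g => ~~ odd (walk_length (pi1_walk g)).

Lemma even_closed : group_closed even_pred.
Proof.
split=> [|g h]; rewrite !unfold_in /= => // ge he.
by rewrite (odd_walk_length_star (pi1_isWalk g) (walk_rev (pi1_isWalk h)))
  /walk_length size_rev (negPf ge) (negPf he).
Qed.

Record even_pi1 : Type :=
  EvenPi1 { even_val : pi1; _ : even_val \in even_pred }.

HB.instance Definition _ := [isSub for even_val].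
HB.instance Definition _ := [Choice of even_pi1 by <:].
HB.instance Definition _ :=
  SubChoice_isSubGroup.Build pi1 even_pred even_pi1 even_closed.

Definition Delta_generators : set pi1 :=
  [set g | exists b p s, [/\ walk a b p, square b s &
    pi1_walk g = star (star p s) (rev p)]].

Definition Delta : normal_subgroup pi1 := normal_closure Delta_generators.

Lemma Delta_even g : normal_set Delta g -> g \in even_pred.
Proof.
suff: (normal_set Delta `<=` [set h | h \in even_pred])%classic by apply.
apply: smallest_sub.
  have [_ D] := even_closed; split=> /=; first by case: even_closed.
  - exact: group_closedM even_closed.
  - exact: group_closedV even_closed.
  - move=> x y xe; rewrite !unfold_in in xe *.
    have wx := pi1_isWalk x; have wy := pi1_isWalk y.
    have wV := walk_rev wy; have wxy := walk_star wx wy.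
    rewrite (odd_walk_length_star wV wxy) (odd_walk_length_star wx wy).
    by rewrite /walk_length size_rev -!/(walk_length _) (negPf xe) addbb.
move=> h [b [p [s [wp /and3P[ws _ /eqP s4] hE]]]] /=.
rewrite unfold_in /= hE (odd_walk_length_star (walk_star wp ws) (walk_rev wp)).
rewrite (odd_walk_length_star wp ws) s4 addbF /walk_length size_rev.
by rewrite addbb.
Qed.

(** [Delta] viewed inside [even_pi1]; nothing is lost, by [Delta_even]. *)

Lemma even_Delta_normal :
  is_normal_subgroup [set g : even_pi1 | normal_set Delta (val g)].
Proof.
have [D1 DM DV DJ] := normalP Delta.
by split=> /= *; [exact: D1|exact: DM|exact: DV|exact: DJ].
Qed.

Definition even_Delta : normal_subgroup even_pi1 :=
  NormalSubgroup even_Delta_normal.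

Definition square_group : groupType := quotient_group Delta.

Definition even_square_group : groupType := quotient_group even_Delta.

End SquareGroup.

Local Open Scope ring_scope.
Local Open Scope classical_set_scope.

Definition l1norm d (v : 'rV[int]_d) : nat := (\sum_(k < d) `|v 0%R k|)%N.

Definition config d (A : finType) : topologicalType :=
  {ptws 'rV[int]_d -> discrete_topology A}.

Definition shift d (A : finType) (n : 'rV[int]_d) (x : config d A) :
    config d A :=
  fun j => x (n + j).

Record subshift d (A : finType) := Subshift {
  points : set (config d A);
  points_closed : closed points;
  points_shift : forall n x, points x -> points (shift n x) }.

Definition point_of d A (X : subshift d A) : topologicalType :=
  set_type (points X).

Definition act d A (X : subshift d A) (n : 'rV[int]_d) (z : point_of X) :
    point_of X :=
  SigSub (mem_set (points_shift n (set_valP z))).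

Definition topologically_mixing d A (X : subshift d A) : Prop :=
  [set: point_of X] !=set0 /\
  forall U V : set (point_of X), open U -> open V -> U !=set0 -> V !=set0 ->
    exists N : nat, forall n : 'rV[int]_d, (N <= l1norm n)%N ->
      U `&` (act n @` V) !=set0.

Section Cohomology.
Local Open Scope group_scope.
Variables (d : nat) (A : finType) (X : subshift d A) (H : groupType).
Implicit Types c : 'rV[int]_d -> point_of X -> H.

Definition cocycle c : Prop :=
  forall m n z, c (m + n)%R z = c m (act n z) * c n z.

Definition continuous_cocycle c : Prop :=
  cocycle c /\
  forall n, continuous (c n : point_of X -> discrete_topology H).

(** When [c n z] does not depend on [z], the cocycle identity says that [c] is a
    group homomorphism from [Z^d] to [H]. *)
Definition homomorphism_cocycle c : Prop :=
  cocycle c /\ forall n z z', c n z = c n z'.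

Definition cohomologous c c' : Prop :=
  exists2 b : point_of X -> H,
    continuous (b : point_of X -> discrete_topology H) &
    forall n z, c n z = (b (act n z))^-1 * c' n z * b z.

Definition trivial_cocycle c : Prop :=
  exists2 c', homomorphism_cocycle c' & cohomologous c c'.

End Cohomology.

Definition cohomologically_trivial d A (X : subshift d A) : Prop :=
  forall (H : groupType) (c : 'rV[int]_d -> point_of X -> H),
    continuous_cocycle c -> trivial_cocycle c.

Section Homshift.
Variables (d : nat) (G : ugraph).

Definition graph_hom : set (config d G) :=
  [set x | forall i j : 'rV[int]_d, l1norm (i - j) = 1%N -> edge (x i) (x j)].

Lemma graph_hom_shift n x : graph_hom x -> graph_hom (shift n x).
Proof. by move=> xG i j ij; apply: xG; rewrite opprD addrACA subrr add0r. Qed.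

Lemma nbhs_config_at (x : config d G) i :
  nbhs x [set y : config d G | y i = x i].
Proof.
exact: (@proj_continuous _ (fun _ => discrete_topology G) i x _
  (@discrete_set1 (discrete_topology G) (x i))).
Qed.

Lemma graph_hom_closed : closed graph_hom.
Proof.
move=> x clx i j ij.
have xi := nbhs_config_at x i; have xj := nbhs_config_at x j.
have [y [yG [/= <- <-]]] := clx _ (filterI xi xj).
exact: yG.
Qed.

Definition homshift : subshift d G :=
  Subshift graph_hom_closed graph_hom_shift.

End Homshift.

(* Main.v *)
Require Import Defs.
From HB Require Import structures.
From mathcomp Require Import all_boot all_order all_algebra.
From mathcomp Require Import boolp classical_sets functions cardinality.
From mathcomp Require Import topology.
From mathcomp Require Import ring zify.

Import Order.TTheory GRing.Theory Num.Theory.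

Set Implicit Arguments.
Unset Strict Implicit.
Unset Printing Implicit Defensive.

(** Mixing forces an odd cycle at [a], so the even cycles have index two in
    [pi1 a], and the last two conditions both say that every even cycle lies in
    [Delta a].

    If the homshift is cohomologically trivial, apply this to the cocycle that
    sends [(n, z)] to the class of the walk read along any path from [n] to [0].
    A checkerboard forces the homomorphism to vanish at [2 e0]; the configuration
    [i |-> p_(sum of the coordinates of i)], for a cycle [p] of even length [2 k],
    is invariant under [2 k e0], whence the class of [p] is trivial.

    Conversely, if all even cycles lie in [Delta a], then two walks with the same
    endpoints and lengths can be joined, once they are followed by enough
    backtracks, by a sequence of changes of one vertex at a time.  A continuous
    cocycle, evaluated along [e0] on configurations constant on the hyperplanes
    of constant coordinate sum, does not see such a change if it takes place far
    from both ends; so there it depends only on the two end windows, and it is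
    cohomologous to a function of the length.  Truncating the other coordinates
    of an arbitrary configuration reduces to that case, and mixing then takes
    care of the other directions. *)

(** * Walks up to squares and backtracks *)

Section WalkHomotopy.
Variable G : ugraph.
Implicit Types (a b c u v x y z : G) (p q s t : seq G).

(** A step keeps the length and both endpoints. Since [x = z] is allowed, exchanging one backtrack
    for another is a step, as is crossing a square. *)
Inductive deform : seq G -> seq G -> Prop :=
| deform_refl s : deform s s
| deform_step s1 s2 t x y y' z :
    edge x y -> edge y z -> edge x y' -> edge y' z ->
    deform (s1 ++ [:: x, y', z & s2]) t -> deform (s1 ++ [:: x, y, z & s2]) t.

Lemma deform_trans s t q : deform s t -> deform t q -> deform s q.
Proof.
by elim=> // s1 s2 {}t x y y' z xy yz xy' yz' _ IH /IH; apply: deform_step.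
Qed.

Lemma deform_flip s1 s2 x y y' z :
    edge x y -> edge y z -> edge x y' -> edge y' z ->
  deform (s1 ++ [:: x, y, z & s2]) (s1 ++ [:: x, y', z & s2]).
Proof.
by move=> xy yz xy' yz'; apply: deform_step xy yz xy' yz' (deform_refl _).
Qed.

Lemma deform_sym s t : deform s t -> deform t s.
Proof.
elim=> [s'|s1 s2 {}t x y y' z xy yz xy' yz' _ IH]; first exact: deform_refl.
by apply: deform_trans IH _; apply: deform_flip.
Qed.

Lemma deform_cat p q s t : deform s t -> deform (p ++ s ++ q) (p ++ t ++ q).
Proof.
elim=> [s'|s1 s2 {}t x y y' z xy yz xy' yz' _ IH]; first exact: deform_refl.
rewrite -catA /= catA; apply: deform_step xy yz xy' yz' _.
by move: IH; rewrite -catA /= catA.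
Qed.

Lemma deform_catl p s t : deform s t -> deform (p ++ s) (p ++ t).
Proof. by move=> st; have := deform_cat p [::] st; rewrite !cats0. Qed.

Lemma deform_cons x s t : deform s t -> deform (x :: s) (x :: t).
Proof. exact: (@deform_catl [:: x]). Qed.

Lemma deform_catr q s t : deform s t -> deform (s ++ q) (t ++ q).
Proof. exact: (@deform_cat [::]). Qed.

Variable nb : G -> G.
Hypothesis edge_nb : forall v, edge v (nb v).

Let edge_nbC v : edge (nb v) v.
Proof. by rewrite edge_sym. Qed.

Definition pad v k : seq G := flatten (nseq k [:: nb v; v]).

Lemma padS v k : pad v k.+1 = [:: nb v, v & pad v k]. Proof. by []. Qed.

Lemma padD v k l : pad v (k + l) = pad v k ++ pad v l.
Proof. by rewrite /pad nseqD flatten_cat. Qed.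

Lemma last_pad v k : last v (pad v k) = v.
Proof. by elim: k. Qed.

(* A backtrack can be carried past one edge: x x' x y, x y x y, x y y' y. *)
Lemma pad1_comm x p : path edge x p ->
  deform [:: x, nb x, x & p] (x :: p ++ [:: nb (last x p); last x p]).
Proof.
elim: p x => [|y p IHp] x /=; first by move=> _; apply: deform_refl.
move=> /andP[xy py]; have yx : edge y x by rewrite edge_sym.
apply: (@deform_trans _ [:: x, y, x, y & p]).
  exact: (@deform_flip [::]).
apply: (@deform_trans _ [:: x, y, nb y, y & p]).
  exact: (@deform_flip [:: x]).
exact/deform_cons/IHp.
Qed.

Lemma pad_comm x p k : path edge x p ->
  deform (x :: pad x k ++ p) (x :: p ++ pad (last x p) k).
Proof.
move=> xp; elim: k => [|k IHk]; first by rewrite cats0; apply: deform_refl.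
rewrite padS /=.
apply: deform_trans (deform_catl [:: x; nb x] IHk) _ => /=.
have xpk : path edge x (p ++ pad (last x p) k).
  rewrite cat_path xp /=; move: (last x p) => y.
  by elim: (k) => //= l ->; rewrite edge_nb edge_nbC.
have := pad1_comm xpk; rewrite last_cat last_pad -catA.
by rewrite -[[:: nb _; _]]/(pad _ 1) -padD addn1.
Qed.

(** [deform] preserves length, so walks of different lengths are compared after padding by
    backtracks; [v] is meant to be their common last vertex. *)
Definition htpy v p q : Prop := exists k l, deform (p ++ pad v k) (q ++ pad v l).

Lemma htpy_refl v p : htpy v p p.
Proof. by exists 0, 0; apply: deform_refl. Qed.

Lemma deform_htpy v p q : deform p q -> htpy v p q.
Proof. by exists 0, 0; rewrite !cats0. Qed.

Lemma htpy_sym v p q : htpy v p q -> htpy v q p.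
Proof. by move=> [k [l /deform_sym pq]]; exists l, k. Qed.

Lemma htpy_trans v p q s : htpy v p q -> htpy v q s -> htpy v p s.
Proof.
move=> [k [l pq]] [k' [l' qs]]; exists (k + k'), (l + l').
apply: (@deform_trans _ (q ++ pad v (l + k'))).
  by rewrite !padD !catA; apply: deform_catr.
by rewrite [l + k']addnC [l + l']addnC !padD !catA; apply: deform_catr.
Qed.

Lemma htpy_cons x v p q : htpy v p q -> htpy v (x :: p) (x :: q).
Proof. by move=> [k [l pq]]; exists k, l; apply: (deform_cons x). Qed.

Lemma htpy_odotl a b c s p q : walk a b s -> walk b c p -> walk b c q ->
  htpy c p q -> htpy c (odot s p) (odot s q).
Proof.
move=> /walkP[s' [-> _ lS]] /walkP[p' [-> _ _]] /walkP[q' [-> _ _]] [k [l pq]].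
exists k, l; rewrite /odot [a :: s']lastI lS /= !cat_rcons -!catA.
exact: deform_catl.
Qed.

(** The padding of [p] and [q] now sits before [s]; [pad_comm] carries it along [s] to the far
    end. *)
Lemma htpy_odotr a b c s p q : walk b c s -> walk a b p -> walk a b q ->
  htpy b p q -> htpy c (odot p s) (odot q s).
Proof.
move=> /walkP[s' [-> sP lS]] /walkP[p' [-> _ lP]] /walkP[q' [-> _ lQ]] [k [l pq]].
have carry r m : last a r = b ->
    deform ((a :: r) ++ pad b m ++ s') ((a :: r) ++ s' ++ pad c m).
  move=> lR; rewrite lastI lR !cat_rcons; apply: deform_catl.
  by have := pad_comm m sP; rewrite lS.
exists k, l; rewrite /odot [behead _]/= -!catA.
apply: deform_trans (deform_sym (carry _ _ lP)) _.
by apply: deform_trans (carry _ _ lQ); rewrite !catA; apply: deform_catr.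
Qed.

(** A padding backtrack moves from the end to the start by [pad1_comm], where one step turns [nb a]
    into [b]. *)
Lemma htpy_backtrack a b c s : walk a c s -> edge a b ->
  htpy c s [:: a, b & s].
Proof.
move=> /walkP[p [-> pP lP]] ab; have ba : edge b a by rewrite edge_sym.
apply: (@htpy_trans _ _ [:: a, nb a, a & p]).
  exists 1, 0; rewrite cats0; apply/deform_sym.
  by have := pad1_comm pP; rewrite lP.
by apply: deform_htpy; apply: (@deform_flip [::]).
Qed.

Lemma htpy_reduce a b s : walk a b s -> htpy b s (reduce s).
Proof.
move=> /walkP[p [-> pP lP]]; elim: p a pP lP => [|x p IHp] a.
  by move=> _ _; apply: htpy_refl.
move=> /= /andP[ax xP] lP; apply: htpy_trans (htpy_cons a (IHp x xP lP)) _.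
have : walk x b (reduce (x :: p)) by apply: walk_reduce; rewrite /= xP lP !eqxx.
rewrite -[push x _]/(reduce (x :: p)).
case: (reduce _) => // y [|z r] /=.
  by move=> _; apply: htpy_refl.
move=> /andP[/eqP -> /andP[/andP[xz zr] lr]].
case: eqP => [za|_]; last exact: htpy_refl.
rewrite -za in ax *; apply: htpy_sym; apply: htpy_backtrack => //.
by rewrite /= eqxx zr lr.
Qed.

Lemma htpy_star a b c p q : walk a b p -> walk b c q ->
  htpy c (star p q) (odot p q).
Proof. by move=> wp wq; exact: htpy_sym (htpy_reduce (walk_odot wp wq)). Qed.

Lemma htpy_starl a b c s p q : walk a b s -> walk b c p -> walk b c q ->
  htpy c p q -> htpy c (star s p) (star s q).
Proof.
move=> ws wp wq pq; apply: htpy_trans (htpy_star ws wp) _.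
exact: htpy_trans (htpy_odotl ws wp wq pq) (htpy_sym (htpy_star ws wq)).
Qed.

Lemma htpy_starr a b c s p q : walk b c s -> walk a b p -> walk a b q ->
  htpy b p q -> htpy c (star p s) (star q s).
Proof.
move=> ws wp wq pq; apply: htpy_trans (htpy_star wp ws) _.
exact: htpy_trans (htpy_odotr ws wp wq pq) (htpy_sym (htpy_star wq ws)).
Qed.

Lemma walk1 a : walk a a [:: a]. Proof. by rewrite /= !eqxx. Qed.

Lemma htpy_1star a b p : walk a b p -> htpy b (star [:: a] p) p.
Proof.
move=> wp; apply: htpy_trans (htpy_star (walk1 a) wp) _.
by case/walkP: wp => p' [-> _ _]; apply: htpy_refl.
Qed.

Lemma htpy_star1 a b p : walk a b p -> htpy b (star p [:: b]) p.
Proof.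
move=> wp; apply: htpy_trans (htpy_star wp (walk1 b)) _.
by rewrite /odot cats0; apply: htpy_refl.
Qed.

(** One step turns [b x y z b] into [b x y x b], whose two nested backtracks can be removed. *)
Lemma htpy_square b s : square b s -> htpy b s [:: b].
Proof.
case/and3P=> /walkP[p [-> + +]] _; case: p => [|x [|y [|z [|t [|]]]]] //=.
move=> /and5P[bx xy yz zt _] tb _; rewrite tb in zt *.
have [xb bz] : edge x b /\ edge b z.
  by split=> //; rewrite edge_sym.
have yx : edge y x by rewrite edge_sym.
apply: (@htpy_trans _ _ [:: b; x; y; x; b]).
  by apply: deform_htpy; apply: (@deform_flip [:: b; x] [::]).
apply: (@htpy_trans _ _ [:: b; x; b]).
  apply: htpy_cons; apply: htpy_sym; apply: htpy_backtrack => //.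
  by rewrite /= xb !eqxx.
apply: htpy_sym; apply: htpy_backtrack => //; exact: walk1.
Qed.

Section Delta.
Variable a : G.

(** As [Delta a] is the smallest normal subgroup containing its generators, this reduces
    [htpy_Delta] to the generators. *)
Lemma htpy1_normal :
  is_normal_subgroup [set g : pi1 a | htpy a (pi1_walk g) [:: a]]%classic.
Proof.
have wkP (g : pi1 a) := pi1_isWalk g; have w1 := walk1 a.
have rl (g : pi1 a) := star_revl (wkP g).
split=> /= [|g h gP hP|g gP|g h gP]; first exact: htpy_refl.
- apply: htpy_trans (htpy_starr (wkP h) (wkP g) w1 gP) _.
  exact: htpy_trans (htpy_1star (wkP h)) hP.
- have wr := walk_rev (wkP g); have := htpy_starl wr (wkP g) w1 gP.
  by rewrite rl => /htpy_sym; apply: htpy_trans (htpy_sym (htpy_star1 wr)).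
- have wr := walk_rev (wkP h); rewrite -(rl h).
  apply: (htpy_starl wr (walk_star (wkP g) (wkP h)) (wkP h)).
  apply: htpy_trans (htpy_starr (wkP h) (wkP g) w1 gP) _.
  exact: htpy_1star (wkP h).
Qed.

Lemma htpy_Delta (g : pi1 a) : normal_set (Delta a) g ->
  htpy a (pi1_walk g) [:: a].
Proof.
move/(_ [set h : pi1 a | htpy a (pi1_walk h) [:: a]]%classic); apply.
split; first exact: htpy1_normal.
move=> h [b [p [s [wp sq hE]]]] /=; rewrite hE.
have ws : walk b b s by case/and3P: sq.
have wr := walk_rev wp; rewrite -(star_revr wp).
apply: (htpy_starr wr (walk_star wp ws) wp).
apply: htpy_trans (htpy_starl wp ws (walk1 b) (htpy_square sq)) _.
exact: htpy_star1 wp.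
Qed.

Hypothesis conn : graph_connected G.
Hypothesis even_Delta :
  forall g : pi1 a, g \in @even_pred G a -> normal_set (Delta a) g.

Lemma connected_walk x y : exists p, walk x y p.
Proof.
have /connectP[p xp ->] := conn x y.
by exists (x :: p); rewrite /= !eqxx xp.
Qed.

(** With [t] a walk from [a] to [u], the cycle that follows [t], [p], then [q] and [t] backwards is
    even, hence null-homotopic. Multiplying by [t] and [q] on the right, then by the reverse of [t]
    on the left, gives the claim. *)
Lemma even_htpy u v p q : walk u v p -> walk u v q ->
  odd (size p) = odd (size q) -> htpy v p q.
Proof.
move=> wp wq opq; have [t wt] := connected_walk a u.
have wt' := walk_rev wt; have wq' := walk_rev wq.
have wl := walk_star wt wp; have wr := walk_star wq' wt'.
have wz := walk_star wl wr.
have gP : reduced_cycle a (star (star t p) (star (rev q) (rev t))).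
  by rewrite /reduced_cycle wz reduce_nonbacktracking.
have wtq := walk_star wt wq.
have /even_Delta/htpy_Delta/= : Pi1 gP \in @even_pred G a.
  rewrite unfold_in /= (odd_walk_length_star wl wr).
  rewrite (odd_walk_length_star wt wp) (odd_walk_length_star wq' wt').
  rewrite /walk_length !size_rev.
  have -> : odd (size p).-1 = odd (size q).-1.
    case/walkP: (wp) opq => p' [-> _ _]; case/walkP: (wq) => q' [-> _ _] /=.
    by move/negb_inj.
  by case: (odd _); case: (odd _).
move/(htpy_starr wtq wz (walk1 a)).
rewrite -(starA wl wr wtq) -(starA wq' wt' wtq) 
  (starA wt' wt wq) (star_revl wt).
have -> : star (rev q) (star [:: u] q) = [:: v].
  rewrite -(star_revl wq).
  case/walkP: wq' => r [-> _ lr]; case/walkP: wq => q' [-> _ _].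
  by rewrite [v :: r]lastI lr star_reducer.
rewrite starr1 ?reduce_nonbacktracking //.
move/(htpy_starl wt' wl (walk_star (walk1 a) wtq)).
rewrite (starA wt' wt wp) (star_revl wt) => tpq.
have wu := walk1 u.
apply: htpy_trans (htpy_sym (htpy_1star wp)) _; apply: htpy_trans tpq _.
have nb_tq : nonbacktracking (star t q) by apply: reduce_nonbacktracking.
rewrite (star1 wtq nb_tq) 
  (starA wt' wt wq) (star_revl wt).
exact: htpy_1star.
Qed.

End Delta.
End WalkHomotopy.
(** * Lattice points and homomorphisms from the lattice *)

Section Lattice.
Local Open Scope ring_scope.
Variable d : nat.
Implicit Types (i j u v : 'rV[int]_d) (k : 'I_d).

Definition unitv k : 'rV[int]_d := delta_mx 0 k.
Definition coordsum v : int := \sum_k v 0%R k.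
Definition inbox (N : nat) v : Prop := forall k, (`|v 0%R k| <= N)%N.

Lemma unitvE k l : unitv k 0%R l = (l == k)%:Z.
Proof. by rewrite mxE eqxx; case: eqP. Qed.

Lemma rVD u v k : (u + v) 0 k = u 0 k + v 0 k. Proof. by rewrite mxE. Qed.

Lemma rVN v k : (- v) 0 k = - v 0 k. Proof. by rewrite mxE. Qed.

Lemma rVMn v n k : (v *+ n) 0 k = v 0 k * n%:Z.
Proof. by rewrite mulmxnE -mulr_natr natz. Qed.

Lemma rVZ (s : int) v k : (s *: v) 0 k = s * v 0 k. Proof. by rewrite mxE. Qed.

Definition rVE := (unitvE, rVD, rVN, rVMn, rVZ).

Lemma coordsumD u v : coordsum (u + v) = coordsum u + coordsum v.
Proof. by rewrite -big_split; apply: eq_bigr => k _; rewrite rVE. Qed.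

Lemma coordsumN v : coordsum (- v) = - coordsum v.
Proof. by rewrite -sumrN; apply: eq_bigr => k _; rewrite mxE. Qed.

Lemma coordsumMn v n : coordsum (v *+ n) = coordsum v *+ n.
Proof. by rewrite -sumrMnl; apply: eq_bigr => k _; rewrite mulmxnE. Qed.

Lemma coordsum_unitv k : coordsum (unitv k) = 1.
Proof.
rewrite /coordsum (bigD1 k) //= unitvE eqxx big1 ?addr0 // => l lk.
by rewrite unitvE (negPf lk).
Qed.

Lemma inbox_coordsum N v : inbox N v -> (`|coordsum v| <= d * N)%N.
Proof.
move=> vN; rewrite -lez_nat abszE.
apply: le_trans (ler_norm_sum _ _ _) _.
apply: (@le_trans _ _ (\sum_(k < d) N%:Z)).
  by apply: ler_sum => k _; rewrite -abszE lez_nat.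
by rewrite sumr_const card_ord -mulr_natl natz PoszM.
Qed.

Lemma inboxW N N' v : (N <= N')%N -> inbox N v -> inbox N' v.
Proof. by move=> NN' vN k; apply: leq_trans NN'. Qed.

Lemma inbox0 N : inbox N 0. Proof. by move=> k; rewrite mxE. Qed.

Lemma inboxD N M u v : inbox N u -> inbox M v -> inbox (N + M) (u + v).
Proof. by move=> uN vM k; rewrite rVE; have := uN k; have := vM k; lia. Qed.

Lemma exists_inbox v : exists N, inbox N v.
Proof.
exists (\max_k `|v 0%R k|%N) => k; exact: (@leq_bigmax _ (fun k => `|v 0%R k|%N)).
Qed.

Lemma l1norm_unitv k n : l1norm (unitv k *+ n) = n.
Proof.
rewrite /l1norm (bigD1 k) //= big1 ?addn0 => [|l lk].
  by rewrite !rVE eqxx mul1r.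
by rewrite !rVE (negPf lk) mul0r.
Qed.

Lemma lattice_ind (P : 'rV[int]_d -> Prop) :
  P 0 -> (forall i k, P i -> P (i + unitv k)) ->
  (forall i k, P i -> P (i - unitv k)) -> forall i, P i.
Proof.
move=> P0 PD PB i; move: {2}(l1norm i).+1 (ltnSn (l1norm i)) => n.
elim: n i => // n IHn i; rewrite ltnS => iN.
have [k ik|i0] := pickP (fun k => i 0%R k != 0); last first.
  suff -> : i = 0 by [].
  by apply/rowP => k; rewrite mxE; apply/eqP; move: (i0 k) => /negbFE.
have step (s : int) : (`|i 0%R k - s| < `|i 0%R k|)%N -> P (i - s *: unitv k).
  move=> ss; apply: IHn; apply: leq_trans iN; rewrite /l1norm (bigD1 k) //=.
  rewrite [X in (_ < X)%N](bigD1 k) //= !rVE eqxx mulr1 -addSn leq_add //.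
  rewrite leq_eqVlt; apply/orP; left; apply/eqP; apply: eq_bigr => l lk.
  by rewrite !rVE (negPf lk) mulr0 subr0.
have [ipos|ineg] : 0 < i 0%R k \/ i 0%R k < 0 by lia.
- have := step 1; rewrite scale1r => /(_ ltac:(lia)) /PD.
  by move=> /(_ k); rewrite subrK.
- have := step (-1); rewrite scaleN1r !opprK => /(_ ltac:(lia)) /PB.
  by move=> /(_ k); rewrite addrK.
Qed.

Lemma l1norm1P v : l1norm v = 1%N -> exists k, v = unitv k \/ v = - unitv k.
Proof.
move=> v1; have [k vk|v0] := pickP (fun k => v 0%R k != 0); last first.
  move: v1; rewrite /l1norm big1 // => k _.
  by move: (v0 k) => /negbFE/eqP->.
move: v1; rewrite /l1norm (bigD1 k) //= => v1.
have vl l : l != k -> v 0%R l = 0.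
  by move=> lk; move: v1; rewrite (bigD1 l) //=; lia.
exists k; have [vE|vE] : v 0%R k = 1 \/ v 0%R k = -1 by lia.
- left; apply/rowP => l; rewrite unitvE.
  by case: eqP => [->|/eqP /vl ->].
- right; apply/rowP => l; rewrite !rVE.
  by case: eqP => [->|/eqP /vl ->] //; rewrite oppr0.
Qed.

End Lattice.

Section HomshiftPoints.
Local Open Scope ring_scope.
Variables (d : nat) (G : ugraph).
Implicit Types (i j u v : 'rV[int]_d) (x y : config d G) (r : int -> G).

Lemma graph_homP x :
  (forall i k, edge (x i) (x (i + unitv k))) <-> graph_hom x.
Proof.
split=> [xE i j|xG i k].
  move/l1norm1P=> [k [|] /(canRL (subrK _)) ->]; rewrite addrC.
    by rewrite edge_sym; apply: xE.
  by have := xE (j - unitv k) k; rewrite subrK.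
apply: xG; rewrite opprD addrA subrr add0r /l1norm.
apply: etrans (l1norm_unitv k 1); apply: eq_bigr => l _.
by rewrite rVN abszN.
Qed.

Definition biwalk r : Prop := forall t, edge (r t) (r (t + 1)).
(** This spreads a two-sided walk over the lattice: a unit step in any direction raises the
    coordinate sum by one. *)
Definition diag r : config d G := fun i => r (coordsum i).
Definition shiftw (n : int) r : int -> G := fun t => r (t + n).

Lemma diag_hom r : biwalk r -> graph_hom (diag r).
Proof.
by move=> rw; apply/graph_homP => i k; rewrite /diag coordsumD coordsum_unitv.
Qed.

Lemma biwalk_shiftw n r : biwalk r -> biwalk (shiftw n r).
Proof. by move=> rw t; rewrite /shiftw addrAC. Qed.

Lemma shift_diag v r : shift v (diag r) = diag (shiftw (coordsum v) r).
Proof. by apply/funext => i; rewrite /shift /diag coordsumD addrC. Qed.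

Lemma shiftD u v x : shift u (shift v x) = shift (u + v) x.
Proof. by apply/funext => i; rewrite /shift addrA [u + v]addrC. Qed.

Lemma shift0 x : shift 0 x = x.
Proof. by apply/funext => i; rewrite /shift add0r. Qed.

Lemma shift_hom v x : graph_hom x -> graph_hom (shift v x).
Proof. exact: graph_hom_shift. Qed.

Definition agree N x y : Prop := forall i, inbox N i -> x i = y i.

Lemma agreeW N N' x y : (N <= N')%N -> agree N' x y -> agree N x y.
Proof. by move=> NN' xy i /(inboxW NN'); apply: xy. Qed.

Lemma agree_shift N M (v : 'rV[int]_d) x y : inbox M v -> agree (M + N) x y ->
  agree N (shift v x) (shift v y).
Proof. by move=> vM xy i iN; apply/xy/inboxD. Qed.

End HomshiftPoints.

Arguments diag d {G} r i.
Arguments diag_hom d {G r}.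

Section Walks.
Local Open Scope ring_scope.
Variable G : ugraph.
Implicit Types (r : int -> G).

Definition joinw m r r' : int -> G := fun t => if t <= m then r t else r' t.

Lemma biwalk_joinw m r r' : biwalk r -> biwalk r' -> r m = r' m ->
  biwalk (joinw m r r').
Proof.
move=> rw rw' mE t; rewrite /joinw; case: ifP => tm; case: ifP => tm' //.
- by have -> : t = m by [lia]; rewrite mE.
- by lia.
Qed.

End Walks.

(** * Cocycles along a direction *)

Section Cocycles.
Local Open Scope ring_scope.
Variables (d : nat) (G : ugraph) (H : groupType).
Variable c : 'rV[int]_d -> config d G -> H.
Hypothesis cM : forall (m n : 'rV[int]_d) x, graph_hom x ->
  c (m + n) x = (c m (shift n x) * c n x)%g.
Implicit Types (i j u v : 'rV[int]_d) (x y : config d G) (r : int -> G).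

Definition radius (f : config d G -> H) N : Prop :=
  forall x y, graph_hom x -> graph_hom y -> agree N x y -> f x = f y.

Lemma radiusW f N N' : (N <= N')%N -> radius f N -> radius f N'.
Proof. by move=> NN' fN x y xG yG /(agreeW NN'); apply: fN. Qed.

Lemma cocycle0 x : graph_hom x -> c 0 x = 1%g.
Proof.
move=> xG; have := cM 0 0 xG; rewrite addr0 shift0.
by move/(congr1 (fun h => h * (c 0 x)^-1)%g); rewrite mulgK mulgV.
Qed.

(** The cocycle identity factors the value at [v *+ m] into values at [v] read around the points
    [v *+ t] with [t < m], so only the boxes at these points matter. *)
Lemma cocycle_line v N m x y : radius (c v) N -> graph_hom x -> graph_hom y ->
  (forall i t, (t < m)%N -> inbox N i -> x (v *+ t + i) = y (v *+ t + i)) ->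
  c (v *+ m) x = c (v *+ m) y.
Proof.
move=> vN xG yG; elim: m => [|m IHm] xy; first by rewrite !mulr0n !cocycle0.
rewrite mulrS !cM // IHm => [|i t tm]; last by apply: xy; lia.
congr (_ * _)%g; apply: vN; [exact: shift_hom|exact: shift_hom|].
by move=> i iN; apply: xy.
Qed.

Variable k0 : 'I_d.
Local Notation e0 := (unitv k0).

Definition rowc (n : nat) r : H := c (e0 *+ n) (diag d r).

Lemma rowcD m n r : biwalk r ->
  rowc (m + n) r = (rowc m (shiftw n r) * rowc n r)%g.
Proof.
move=> rw; rewrite /rowc mulrnDr cM; last exact: diag_hom.
by rewrite shift_diag coordsumMn coordsum_unitv natz.
Qed.

Variable N : nat.
Hypothesis radius_e0 : radius (c e0) N.
Let L : nat := (d * N)%N.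

Lemma rowc_local n r r' : biwalk r -> biwalk r' ->
  (forall t : int, - L%:Z <= t <= n%:Z + L%:Z -> r t = r' t) ->
  rowc n r = rowc n r'.
Proof.
move=> rw rw' rr'; apply: (cocycle_line radius_e0); try exact: diag_hom.
move=> i t tn iN; apply: rr'; rewrite coordsumD coordsumMn coordsum_unitv natz.
by have := inbox_coordsum iN; rewrite -/L; lia.
Qed.

Variable k1 : 'I_d.
Hypothesis k01 : k0 != k1.
Local Notation e1 := (unitv k1).
Hypothesis radius_e10 : radius (c (e1 - e0)) N.

(* Glue [diag r] below and [diag r'] above a hyperplane, and compare the value
   of the cocycle along two parallels to [e0], far below and far above.  They
   are joined by segments along [e1 - e0], a direction in which [diag r] is
   constant, which stay away from the place where [r] and [r'] differ. *)
Lemma rowc_flip n (k : int) r r' : biwalk r -> biwalk r' ->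
  L%:Z < k < n%:Z - L%:Z -> (forall t : int, t != k -> r t = r' t) ->
  rowc n r = rowc n r'.
Proof.
(* [K] exceeds [N], so the boxes of size [N] around either row stay on one side of the
   hyperplane. *)
move=> rw rw' kn rr'; pose u : 'rV[int]_d := e1 - e0; pose K := N.+1.
pose W : config d G := fun i => if i 0%R k1 < 0 then diag d r i else diag d r' i.
have WG : graph_hom W.
  apply/graph_homP => i l; rewrite /W /diag !rVE coordsumD coordsum_unitv.
  case: ifP => ik; case: ifP => jk //.
    (* An edge across the hyperplane reads [r] and then [r'] at consecutive times, at most one of
       which is [k]. *)
    have [sk|sk] := eqVneq (coordsum i) k.
      by rewrite -rr'; [exact: rw|lia].
    by rewrite rr' //; exact: rw'.
  by lia.
have uS : coordsum u = 0 by rewrite coordsumD coordsumN !coordsum_unitv subrr.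
have u1 : u 0%R k1 = 1 by rewrite !rVE eqxx eq_sym (negPf k01) subr0.
have rG := diag_hom d rw; have rG' := diag_hom d rw'.
pose x := shift (- (u *+ K)) W.
have xG : graph_hom x by exact: shift_hom.
have W_diag i : (i 0%R k1 < 0 \/ coordsum i != k) -> W i = diag d r i.
  by rewrite /W /diag; case: ifP => // _ [//|/rr'->].
have xE i : x i = W (i - u *+ K) by rewrite /x /shift addrC.
have SuK m : coordsum (u *+ m) = 0 by rewrite coordsumMn uS mul0rn.
have bottom : c (e0 *+ n) x = rowc n r.
  apply: (cocycle_line radius_e0) => // i t tn iN; rewrite xE W_diag.
    by rewrite /diag !coordsumD coordsumN SuK subr0.
  left; rewrite !rVE [k1 == k0]eq_sym (negPf k01) eqxx.
  by have := iN k1; rewrite /K; lia.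
have top : c (e0 *+ n) (shift (u *+ (K + K)) x) = rowc n r'.
  rewrite /x shiftD mulrnDr addrK.
  apply: (cocycle_line radius_e0) => // [|i t tn iN]; first exact: shift_hom.
  rewrite /shift {1}/W ifF.
    by rewrite /diag !coordsumD SuK add0r.
  rewrite !rVE [k1 == k0]eq_sym (negPf k01) eqxx.
  by have := iN k1; rewrite /K; lia.
have left_side : c (u *+ (K + K)) x = c (u *+ (K + K)) (diag d r).
  apply: (cocycle_line radius_e10) => // i t tn iN; rewrite xE W_diag.
    by rewrite /diag !coordsumD coordsumN !SuK subr0.
  right; rewrite !coordsumD coordsumN !SuK.
  by have := inbox_coordsum iN; rewrite -/L; lia.
have right_side : c (u *+ (K + K)) (shift (e0 *+ n) x)
    = c (u *+ (K + K)) (shift (e0 *+ n) (diag d r)).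
  apply: (cocycle_line radius_e10); try exact: shift_hom.
  move=> i t tn iN; rewrite /shift xE W_diag.
    by rewrite /diag !coordsumD coordsumN !SuK subr0.
  right; rewrite !coordsumD coordsumN !SuK coordsumMn coordsum_unitv natz.
  by have := inbox_coordsum iN; rewrite -/L; lia.
(* The parallelogram on [e0 *+ n] and [u *+ (K + K)] is traversed in both orders, for [x] and for
   [diag d r]. The sides along [u] cancel and leave the two rows. *)
have Ex := cM (e0 *+ n) (u *+ (K + K)) xG.
rewrite addrC cM // bottom right_side left_side top in Ex.
have Er := cM (e0 *+ n) (u *+ (K + K)) rG.
rewrite addrC cM // [shift (u *+ _) _]shift_diag SuK in Er.
have s0 : shiftw 0 r = r by apply/funext => t; rewrite /shiftw addr0.
rewrite s0 -/(rowc n r) in Er.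
by move: Ex; rewrite Er => /mulIg.
Qed.

End Cocycles.

(** * Infinite continuation of finite walks by backtracks *)

Section Extension.
Local Open Scope ring_scope.
Variables (G : ugraph) (nb : G -> G).
Hypothesis edge_nb : forall v, edge v (nb v).
Implicit Types (v x y z : G) (p q s : seq G) (r : int -> G) (i t k : int).
Local Notation pad := (pad nb).

Lemma size_pad v n : size (pad v n) = n.*2.
Proof. by elim: n => //= n ->. Qed.

(* The walk [r] before time [i], then [s], then back and forth between its
   last vertex [v] and [nb v] for ever; the padding only has to be long enough
   to reach time [t]. *)
Definition extw r i s v : int -> G :=
  fun t => if t < i then r t else nth v (s ++ pad v `|t - i|) `|t - i|.

Lemma nth_pad v s n m : (n <= m)%N -> (0 < size s)%N ->
  nth v (s ++ pad v m) n = nth v (s ++ pad v n) n.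
Proof.
move=> nm s0; rewrite -(subnKC nm) padD catA nth_cat size_cat size_pad.
by rewrite ifT //; lia.
Qed.

(** The continuation consists of the same backtracks, so the padding in [htpy] becomes invisible. *)
Lemma extw_pad r i s v n : (0 < size s)%N ->
  extw r i (s ++ pad v n) v = extw r i s v.
Proof.
move=> s0; apply/funext => t; rewrite /extw; case: ifP => // _.
rewrite -catA -padD nth_pad //; lia.
Qed.

Lemma extw_in r i s v t : i <= t < i + (size s)%:Z ->
  extw r i s v t = nth v s `|t - i|.
Proof. by move=> it; rewrite /extw ifF ?nth_cat ?ifT //; lia. Qed.

Lemma extw_after r i s v t : i + (size s)%:Z <= t ->
  extw r i s v t = nth v (pad v `|t - i|) (`|t - i| - size s).
Proof. by move=> it; rewrite /extw ifF ?nth_cat ?ifF //; lia. Qed.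

Lemma path_pad v n : path edge v (pad v n).
Proof. by elim: n => //= n ->; rewrite edge_nb edge_sym edge_nb. Qed.

Lemma biwalk_extw r i s x v : biwalk r -> edge (r (i - 1)) x -> walk x v s ->
  biwalk (extw r i s v).
Proof.
move=> rw rx ws t; rewrite /extw; case: ifP => ti; case: ifP => ti'.
- exact: rw.
- have -> : t + 1 - i = 0 by lia.
  have <- : i - 1 = t by lia.
  by case/walkP: ws => p [-> _ _].
- by lia.
- have -> : `|(t + 1 - i)%R|%N = `|(t - i)%R|.+1 by lia.
  move: `|t - i|%N => m; have s0 : (0 < size s)%N by case: (s) ws.
  rewrite -(@nth_pad v s m m.+1) //; case/walkP: ws => p [-> pP lP].
  apply: (@pathP _ edge x (p ++ pad v m.+1) v _).
    by rewrite cat_path pP lP path_pad.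
  by rewrite size_cat size_pad; lia.
Qed.

Lemma deform_walk p q x v : deform p q -> walk x v p -> walk x v q.
Proof.
elim=> // s1 s2 t a b b' c ab bc ab' bc' _ IH wp; apply: IH; move: wp.
case: s1 => [|u s1] /=.
  by rewrite ab bc ab' bc'.
by rewrite !cat_path /= ab bc ab' bc' !last_cat.
Qed.

(** A step of [deform] changes the continued walk at a single time, as [rowc_flip] requires. *)
Lemma extw_flip r i s1 s2 x y y' z v t : t != i + (size s1)%:Z + 1 ->
  extw r i (s1 ++ [:: x, y, z & s2]) v t =
  extw r i (s1 ++ [:: x, y', z & s2]) v t.
Proof.
move=> tk; rewrite /extw; case: ifP => // ti; rewrite -!catA !nth_cat.
case: ifP => // m1; have: (`|t - i| - size s1 != 1)%N by lia.
by case: (_ - _)%N => [|[|m]].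
Qed.

End Extension.

Lemma walk_mkseq (G : ugraph) (r : int -> G) (m : int) n : biwalk r ->
  walk (r m) (r (m + n%:Z)%R) (mkseq (fun j => r (m + j%:Z)%R) n.+1).
Proof.
move=> rw; apply/walkP; exists (mkseq (fun j => r (m + j.+1%:Z)%R) n).
suff [pn ln] : path edge (r m) (mkseq (fun j => r (m + j.+1%:Z)%R) n) /\
    last (r m) (mkseq (fun j => r (m + j.+1%:Z)%R) n) = r (m + n%:Z)%R.
  split=> //; rewrite /mkseq /= (iotaDl 1) -map_comp; congr (r _ :: _); lia.
elim: n => [|n [pn ln]]; first by split=> //=; congr r; lia.
rewrite mkseqS rcons_path last_rcons pn ln; split=> //=.
have -> : (m + n.+1%:Z = m + n%:Z + 1)%R by lia.
exact: rw.
Qed.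

(** * Rigidity of row values under homotopy *)

Section RowRigidity.
Local Open Scope ring_scope.
Variables (d : nat) (G : ugraph) (H : groupType).
Variable c : 'rV[int]_d -> config d G -> H.
Hypothesis cM : forall (m n : 'rV[int]_d) x, graph_hom x ->
  c (m + n) x = (c m (shift n x) * c n x)%g.
Variables k0 k1 : 'I_d.
Hypothesis k01 : k0 != k1.
Variable N : nat.
Hypothesis radius_e0 : radius (c (unitv k0)) N.
Hypothesis radius_e10 : radius (c (unitv k1 - unitv k0)) N.
Let L : nat := (d * N)%N.
Local Notation rowc := (rowc c k0).
Variable nb : G -> G.
Hypothesis edge_nb : forall v, edge v (nb v).
Hypothesis same_parity_htpy : forall (u v : G) p q, walk u v p -> walk u v q ->
  odd (size p) = odd (size q) -> htpy nb v p q.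
Implicit Types (v x y z : G) (p q s : seq G) (r : int -> G) (i t k : int).
Local Notation ext := (extw nb).

(** Each step is an instance of [rowc_flip]: the bounds keep the interior times of the segment
    strictly between [L] and [n - L]. *)
Lemma rowc_deform n r i s s' x v : biwalk r -> edge (r (i - 1)) x ->
    walk x v s -> L%:Z <= i -> i + (size s)%:Z <= n%:Z - L%:Z ->
  deform s s' -> rowc n (ext r i s v) = rowc n (ext r i s' v).
Proof.
move=> rw rx ws Li + sD; elim: sD ws => // s1 s2 {}s' a b b' c' ab bc ab' bc' _.
move=> IH ws sn.
have ws' := deform_walk (deform_flip s1 s2 ab bc ab' bc') ws.
rewrite -IH //; last by move: sn; rewrite !size_cat.
apply: (rowc_flip cM radius_e0 k01 radius_e10 (k := i + (size s1)%:Z + 1)).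
- exact: biwalk_extw rx ws.
- exact: biwalk_extw rx ws'.
- by move: sn; rewrite size_cat /=; lia.
- by move=> t; apply: extw_flip.
Qed.

Lemma rowc_htpy r i p q x v : biwalk r -> edge (r (i - 1)) x ->
    walk x v p -> walk x v q -> L%:Z <= i -> htpy nb v p q ->
  exists n0, forall n, (n0 <= n)%N ->
    rowc n (ext r i p v) = rowc n (ext r i q v).
Proof.
move=> rw rx wp wq Li [k [l pq]].
exists (`|i| + size (p ++ pad nb v k) + L)%N => n n0.
have p0 : (0 < size p)%N by case: (p) wp.
have q0 : (0 < size q)%N by case: (q) wq.
rewrite -(extw_pad nb r i v k p0) -(extw_pad nb r i v l q0).
apply: (rowc_deform (x := x)) => //; last by lia.
case/walkP: wp => p' [-> pP lP] /=.
by rewrite eqxx cat_path pP lP path_pad // last_cat lP last_pad eqxx.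
Qed.

(* Both walks are continued by the same endless alternation: over a long enough
   time, the homotopy between the two padded segments takes place away from
   both ends. *)
Lemma rowc_ends n r r' : biwalk r -> biwalk r' ->
  (forall t, t <= L%:Z -> r t = r' t) ->
  (forall t, n%:Z - L%:Z <= t <= n%:Z + L%:Z -> r t = r' t) ->
  rowc n r = rowc n r'.
Proof.
move=> rw rw' rl rr.
pose seg r := mkseq (fun j => r (L%:Z + j%:Z)) n.+1.
pose v := r (n%:Z + L%:Z).
have segN r2 : size (seg r2) = n.+1 by rewrite size_mkseq.
have seg_walk r2 : biwalk r2 -> walk (r2 L%:Z) (r2 (n%:Z + L%:Z)) (seg r2).
  by move=> r2w; rewrite [n%:Z + _]addrC; apply: walk_mkseq.
have ext_seg r2 t : r2 =1 r \/ r2 =1 r' -> t <= n%:Z + L%:Z ->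
    ext r2 L%:Z (seg r2) v t = r2 t.
  move=> _ tn; have [tL|tL] := ltP t L%:Z; first by rewrite /extw tL.
  rewrite extw_in ?segN; last by lia.
  by rewrite nth_mkseq; [congr r2; lia|lia].
have vE : r' (n%:Z + L%:Z) = v by rewrite /v rr //; lia.
have ws := seg_walk _ rw; have ws' := seg_walk _ rw'.
rewrite -/v vE -(rl L%:Z (lexx _)) in ws ws'.
have rx : edge (r (L%:Z - 1)) (r L%:Z) by have := rw (L%:Z - 1); rewrite subrK.
have bw := biwalk_extw edge_nb rw rx ws.
have bw' := biwalk_extw edge_nb rw rx ws'.
have E' : ext r' L (seg r') v = ext r L (seg r') v.
  apply/funext => t; rewrite /extw; case: ifP => // tL.
  by rewrite rl //; lia.
have -> : rowc n r = rowc n (ext r L%:Z (seg r) v).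
  apply: (rowc_local cM radius_e0) => // t /andP[_ tn].
  by rewrite ext_seg //; left.
have -> : rowc n r' = rowc n (ext r L%:Z (seg r') v).
  apply: (rowc_local cM radius_e0) => // t /andP[_ tn].
  by rewrite -E' ext_seg //; right.
have hpq : htpy nb v (seg r) (seg r').
  by apply: same_parity_htpy ws ws' _; rewrite !segN.
have [n0 hn0] := rowc_htpy rw rx ws ws' (lexx _) hpq.
(* Over [n0 + n] steps the values agree. From time [n - L] on the two continued walks coincide: up
   to [n + L] by assumption, later because the segments have the same size. So the last [n0] steps
   give equal factors, which cancel. *)
have := hn0 (n0 + n)%N (leq_addr _ _).
rewrite !(rowcD cM) // => E.
suff tail : rowc n0 (shiftw n (ext r L (seg r) v))
          = rowc n0 (shiftw n (ext r L (seg r') v)).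
  by move: E; rewrite tail => /mulgI.
apply: (rowc_local cM radius_e0); try exact: biwalk_shiftw.
move=> t /andP[tl _]; rewrite /shiftw.
have [tn|tn] := leP (t + n%:Z) (n%:Z + L%:Z).
  rewrite ext_seg //; last by left.
  rewrite -E' ext_seg //; last by right.
  by apply: rr; lia.
by rewrite !extw_after ?segN //; lia.
Qed.

End RowRigidity.

(** * Row values as a coboundary *)

Section RowTrivial.
Local Open Scope ring_scope.
Variables (d : nat) (G : ugraph) (H : groupType).
Variable c : 'rV[int]_d -> config d G -> H.
Hypothesis cM : forall (m n : 'rV[int]_d) x, graph_hom x ->
  c (m + n) x = (c m (shift n x) * c n x)%g.
Variable k0 : 'I_d.
Variable N : nat.
Hypothesis radius_e0 : radius (c (unitv k0)) N.
Let L : nat := (d * N)%N.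
Local Notation rowc := (rowc c k0).
Hypothesis rowc_ends : forall n r r', biwalk r -> biwalk r' ->
  (forall t : int, t <= L%:Z -> r t = r' t) ->
  (forall t : int, n%:Z - L%:Z <= t <= n%:Z + L%:Z -> r t = r' t) ->
  rowc n r = rowc n r'.
Variable M : nat.
Hypothesis connect_walks : forall n (x y : G), (M <= n)%N ->
  exists r, [/\ biwalk r, r 0 = x & r n%:Z = y].
Implicit Types (r s : int -> G) (t : int).

Lemma rowc_windows n r r' : biwalk r -> biwalk r' ->
  (forall t, - L%:Z <= t <= L%:Z -> r t = r' t) ->
  (forall t, n%:Z - L%:Z <= t <= n%:Z + L%:Z -> r t = r' t) ->
  rowc n r = rowc n r'.
Proof.
move=> rw rw' r0 rn; have jw : biwalk (joinw L%:Z r r').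
  by apply: biwalk_joinw => //; apply: r0; lia.
rewrite (rowc_ends rw jw).
- apply: (rowc_local cM radius_e0) => // t tn; rewrite /joinw.
  by case: ifP => // tL; apply: r0; lia.
- by move=> t tL; rewrite /joinw tL.
- by move=> t tn; rewrite /joinw; case: ifP => // _; apply: rn.
Qed.

(** The gap between the times [L] and [n - L] has length at least [M], enough to connect any two
    vertices. *)
Lemma glue_walks n r r' : biwalk r -> biwalk r' -> (M + L + L < n)%N ->
  exists s, [/\ biwalk s, forall t, t <= L%:Z -> s t = r t
    & forall t, n%:Z - L%:Z <= t -> s t = r' (t - n%:Z)].
Proof.
move=> rw rw' nM.
have [|p [pw p0 pn]] := @connect_walks (n - L - L) (r L%:Z) (r' (- L%:Z)).
  by lia.
exists (joinw L%:Z r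
  (joinw (n%:Z - L%:Z) (shiftw (- L%:Z) p) (shiftw (- n%:Z) r'))).
split.
- apply: biwalk_joinw => //.
    apply: biwalk_joinw; try exact: biwalk_shiftw.
    rewrite /shiftw (_ : n%:Z - L%:Z - L%:Z = (n - L - L)%N%:Z); last by lia.
    by rewrite pn; congr r'; lia.
  by rewrite /joinw /shiftw ifT ?subrr ?p0 //; lia.
- by move=> t tL; rewrite /joinw tL.
- move=> t tn; rewrite /joinw ifF; last by lia.
  case: ifP => // tn'; rewrite /shiftw.
  rewrite (_ : t - L%:Z = (n - L - L)%N%:Z); last by lia.
  by rewrite pn; congr r'; lia.
Qed.

(* [b r] is the value on a walk from the window of [r] at [0] to the window of a
   reference walk at time [m]; [h n] is the value on a walk between two copies
   of the reference window, at distance [n]. *)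
Lemma rowc_trivial : exists (b : (int -> G) -> H) (h : nat -> H) (n0 : nat),
  (forall r r', biwalk r -> biwalk r' ->
     (forall t, - L%:Z <= t <= L%:Z -> r t = r' t) -> b r = b r') /\
  (forall n r, (n0 <= n)%N -> biwalk r ->
     (b (shiftw n r) * rowc n r = h n * b r)%g).
Proof.
(* Without vertices there is no two-sided walk, and any values will do. *)
have [[v]|noG] := pselect (exists v : G, True); last first.
  exists (fun=> 1%g), (fun=> 1%g), 0%N.
  by split=> // n r _; case: noG; exists (r 0).
have [ro [row _ _]] := @connect_walks M v v (leqnn M).
pose m := (M + L + L).+1.
pose bspec r h := biwalk r -> exists s, [/\ biwalk s,
  forall t, t <= L%:Z -> s t = r t,
  forall t, m%:Z - L%:Z <= t -> s t = ro (t - m%:Z) & h = rowc m s].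
have /choice[b bP] : forall r, exists h, bspec r h.
  move=> r; have [rw|nrw] := pselect (biwalk r); last by exists 1%g.
  have [s [sw s1 s2]] := glue_walks rw row (leqnn m).
  by exists (rowc m s) => _; exists s.
pose hspec n h := (m <= n)%N -> exists s, [/\ biwalk s,
  forall t, t <= L%:Z -> s t = ro t,
  forall t, n%:Z - L%:Z <= t -> s t = ro (t - n%:Z) & h = rowc n s].
have /choice[h hP] : forall n, exists h, hspec n h.
  move=> n; have [mn|nm] := leqP m n; last by exists 1%g; rewrite /hspec; lia.
  have [s [sw s1 s2]] := glue_walks row row mn.
  by exists (rowc n s) => _; exists s.
exists b, h, m; split=> [r r' rw rw' rr'|n r mn rw].
  have [s [sw s1 s2 ->]] := bP r rw; have [s' [sw' s1' s2' ->]] := bP r' rw'.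
  apply: rowc_windows => // t tL.
    by rewrite s1 ?s1' ?rr' //; lia.
  by rewrite s2 ?s2' //; lia.
have [s [sw s1 s2 ->]] := bP r rw.
have [s' [sw' s1' s2' ->]] := bP _ (biwalk_shiftw n%:Z rw).
have [q [qw q1 q2 ->]] := hP n mn.
(* Both [u] and [w] run from the window of [r] at [0] to that of [ro], placed at time [m + n]; [u]
   passes the window of [r] at [n], and [w] that of [ro], placed at [m]. [rowc_windows] equates
   their values, which [rowcD] splits into the two sides of the claim. *)
pose u := joinw n%:Z r (shiftw (- n%:Z) s').
have uw : biwalk u.
  apply: biwalk_joinw => //; first exact: biwalk_shiftw.
  by rewrite /shiftw subrr s1' // /shiftw add0r.
have un t : - L%:Z <= t -> shiftw n%:Z u t = s' t.
  move=> tL; rewrite /shiftw /u /joinw; case: ifP => tn; last first.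
    by rewrite /shiftw addrK.
  by rewrite s1' //; lia.
have u0 t : t <= n%:Z + L%:Z -> u t = r t.
  move=> tL; rewrite /u /joinw; case: ifP => // tn.
  by rewrite /shiftw s1'; [rewrite /shiftw subrK|lia].
pose w := joinw m%:Z s (shiftw (- m%:Z) q).
have ww : biwalk w.
  apply: biwalk_joinw => //; first exact: biwalk_shiftw.
  by rewrite /shiftw subrr q1 // s2 ?subrr //; lia.
have wm t : - L%:Z <= t -> shiftw m%:Z w t = q t.
  move=> tL; rewrite /shiftw /w /joinw; case: ifP => tn; last first.
    by rewrite /shiftw addrK.
  by rewrite s2 ?q1 ?addrK //; lia.
have w0 t : t <= m%:Z + L%:Z -> w t = s t.
  move=> tL; rewrite /w /joinw; case: ifP => // tn.
  by rewrite /shiftw q1 ?s2 //; lia.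
have -> : rowc n r = rowc n u.
  by apply: (rowc_local cM radius_e0) => // t /andP[_ /u0].
have -> : rowc m s' = rowc m (shiftw n u).
  apply: (rowc_local cM radius_e0) => //; first exact: biwalk_shiftw.
  by move=> t /andP[/un->].
have -> : rowc m s = rowc m w.
  by apply: (rowc_local cM radius_e0) => // t /andP[_ /w0].
have -> : rowc n q = rowc n (shiftw m w).
  apply: (rowc_local cM radius_e0) => //; first exact: biwalk_shiftw.
  by move=> t /andP[/wm->].
rewrite -!(rowcD cM) // [(m + n)%N]addnC.
apply: rowc_windows => // t tL.
  by rewrite u0 ?w0 ?s1 //; lia.
rewrite (_ : u t = s' (t - n%:Z)); last first.
  by rewrite -un ?/shiftw ?subrK //; lia.
rewrite (_ : w t = q (t - m%:Z)); last first.
  by rewrite -wm ?/shiftw ?subrK //; lia.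
by rewrite s2' ?q2; [congr ro; lia|lia|lia].
Qed.

End RowTrivial.

(** * Reduction to rows *)

Section Fold.
Local Open Scope ring_scope.
Variables (d : nat) (k0 : 'I_d) (N : nat).
Implicit Types (i j v : 'rV[int]_d) (k : 'I_d).
Local Notation e0 := (unitv k0).

Definition overshoot (t : int) : int := if t <= N%:Z then 0 else t - N%:Z.

(* The coordinates other than [k0] are truncated at [N], and what is cut off is
   added to the coordinate [k0]: neighbours are sent to neighbours. *)
Definition fold i : 'rV[int]_d :=
  i + \sum_k overshoot (i 0 k) *: (e0 - unitv k).

Definition onesv : 'rV[int]_d := \sum_k unitv k.

Lemma fold_step i k : fold (i + unitv k) = fold i + unitv k \/
  fold (i + unitv k) = fold i + e0.
Proof.
have -> : fold (i + unitv k) = fold i + unitv k +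
    (overshoot (i 0 k + 1) - overshoot (i 0 k)) *: (e0 - unitv k).
  rewrite /fold (bigD1 k) //= [in RHS](bigD1 k) //=.
  rewrite (eq_bigr (fun l => overshoot (i 0 l) *: (e0 - unitv l))) => [|l lk].
    rewrite !rVE eqxx; set S := \sum_(_ | _) _.
    by apply/rowP => l; rewrite !rVE; ring.
  by rewrite !rVE (negPf lk) addr0.
rewrite /overshoot; case: ifP => t1; case: ifP => t2.
- by left; rewrite subrr scale0r addr0.
- by exfalso; lia.
- right; rewrite (_ : _ - 0 = 1); last by lia.
  by rewrite scale1r -addrA [unitv k + _]addrC subrK.
- right; rewrite (_ : _ - (_ - _) = 1); last by lia.
  by rewrite scale1r -addrA [unitv k + _]addrC subrK.
Qed.

Lemma fold_id i : (forall k, k != k0 -> i 0 k <= N%:Z) -> fold i = i.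
Proof.
move=> iN; rewrite /fold big1 ?addr0 // => k _.
have [->|kk0] := eqVneq k k0; first by rewrite subrr scaler0.
by rewrite /overshoot iN // scale0r.
Qed.

Lemma sum_unitv i : \sum_k i 0 k *: unitv k = i.
Proof. exact/esym/row_sum_delta. Qed.

(** Here only the coordinate sum survives, so a homomorphism composed with [fold] is, in this
    region, constant on hyperplanes of constant sum. *)
Lemma fold_far i : (forall k, k != k0 -> N%:Z <= i 0 k) ->
  fold i = (coordsum i - (d * N)%N%:Z) *: e0 + N%:Z *: onesv.
Proof.
move=> iN; rewrite /fold.
have -> : \sum_k overshoot (i 0 k) *: (e0 - unitv k)
    = \sum_k (i 0 k - N%:Z) *: (e0 - unitv k).
  apply: eq_bigr => k _.
  have [->|kk0] := eqVneq k k0; first by rewrite subrr !scaler0.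
  have := iN k kk0; rewrite /overshoot; case: ifP => // t1 t2.
  by rewrite (_ : i 0 k = N%:Z) ?subrr //; lia.
have -> : \sum_k (i 0 k - N%:Z) *: (e0 - unitv k)
   = (\sum_k (i 0 k - N%:Z)) *: e0 - \sum_k (i 0 k *: unitv k)
     + \sum_k N%:Z *: unitv k.
  rewrite scaler_suml -sumrB -big_split /=; apply: eq_bigr => k _.
  by apply/rowP => l; rewrite !rVE; ring.
rewrite sum_unitv -scaler_sumr -/onesv sumrB sumr_const card_ord.
rewrite -/(coordsum i) (_ : N%:Z *+ d = (d * N)%N%:Z); last first.
  by rewrite -mulr_natl natz PoszM.
by apply/rowP => l; rewrite !rVE; ring.
Qed.

Lemma foldD i n : fold (e0 *+ n + i) = e0 *+ n + fold i.
Proof.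
rewrite /fold -addrA; congr (_ + (_ + _)); apply: eq_bigr => k _.
have [->|kk0] := eqVneq k k0; first by rewrite subrr !scaler0.
by rewrite !rVE (negPf kk0) mul0r add0r.
Qed.

Lemma inbox_fold R i : inbox R i -> inbox (R + d * R) (fold i).
Proof.
move=> iR; apply: inboxD => // l; rewrite summxE.
rewrite -lez_nat abszE; apply: le_trans (ler_norm_sum _ _ _) _.
apply: (@le_trans _ _ (\sum_(k < d) R%:Z)); last first.
  by rewrite sumr_const card_ord -mulr_natl natz PoszM.
apply: ler_sum => k _; rewrite !rVE; have := iR k; rewrite /overshoot.
by case: ifP => tN; case: (l == k0); case: (l == k); lia.
Qed.

End Fold.

(** * Walks of prescribed length from mixing *)

Section ConnectingWalks.
Local Open Scope ring_scope.
Variables (d : nat) (G : ugraph) (k0 : 'I_d).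
Local Notation e0 := (unitv k0).
Variable nb : G -> G.
Hypothesis edge_nb : forall v, edge v (nb v).

Lemma fold_hom N (x : config d G) : graph_hom x -> graph_hom (fun i => x (fold k0 N i)).
Proof.
move=> /graph_homP xG; apply/graph_homP => i k.
by case: (fold_step k0 N i k) => ->; apply: xG.
Qed.

Lemma biwalk_alternating (v : G) :
  biwalk (fun t : int => if odd `|t|%N then nb v else v).
Proof.
move=> t; have -> : odd (absz (t + 1)) = ~~ odd (absz t) by lia.
by case: (odd _) => /=; rewrite ?edge_nb // edge_sym.
Qed.

Hypothesis mixing : forall (x y : config d G) (R : nat),
  graph_hom x -> graph_hom y -> exists M, forall n, (M <= n)%N ->
  exists z, [/\ graph_hom z, agree R z x & agree R (shift (e0 *+ n) z) y].

(** Mixing is applied to the alternating configurations showing [u] and [v] at the origin, and the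
    result is read along [e0]. [M] is a maximum over the finitely many pairs of vertices. *)
Lemma connecting_walks : exists M, forall n (u v : G), (M <= n)%N ->
  exists r, [/\ biwalk r, r 0 = u & r n%:Z = v].
Proof.
have b0 : inbox 0 (0 : 'rV[int]_d) by exact: inbox0.
have S0 : coordsum (0 : 'rV[int]_d) = 0.
  by rewrite /coordsum big1 // => k _; rewrite mxE.
have wit (uv : G * G) : exists M, forall n, (M <= n)%N ->
    exists r, [/\ biwalk r, r 0 = uv.1 & r n%:Z = uv.2].
  case: uv => u v.
  have uG := diag_hom d (biwalk_alternating u).
  have vG := diag_hom d (biwalk_alternating v).
  have [M hM] := mixing 0 uG vG.
  exists M => n /hM[z [/graph_homP zG zu zv]].
  exists (fun t => z (t *: e0)); split=> [t||].
  - by rewrite scalerDl scale1r; apply: zG.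
  - by rewrite scale0r zu // /diag S0.
  - have /= := zv _ b0; rewrite /shift addr0 -scaler_nat natz /= => ->.
    by rewrite /diag S0.
have [f fP] := choice wit.
exists (\max_uv f uv)%N => n u v Mn; apply: (fP (u, v)).
exact: leq_trans (leq_bigmax _) Mn.
Qed.

End ConnectingWalks.

(** * From rows to arbitrary configurations and directions *)

Section Trivialization.
Local Open Scope ring_scope.
Variables (d : nat) (G : ugraph) (H : groupType).
Variable c : 'rV[int]_d -> config d G -> H.
Hypothesis cM : forall (m n : 'rV[int]_d) x, graph_hom x ->
  c (m + n) x = (c m (shift n x) * c n x)%g.
Hypothesis cR : forall m, exists N, radius (c m) N.
Variables k0 k1 : 'I_d.
Hypothesis k01 : k0 != k1.
Local Notation e0 := (unitv k0).
Hypothesis mixing : forall (x y : config d G) (R : nat),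
  graph_hom x -> graph_hom y -> exists M, forall n, (M <= n)%N ->
  exists z, [/\ graph_hom z, agree R z x & agree R (shift (e0 *+ n) z) y].
Variable nb : G -> G.
Hypothesis edge_nb : forall v, edge v (nb v).
Hypothesis same_parity_htpy : forall (u v : G) p q, walk u v p -> walk u v q ->
  odd (size p) = odd (size q) -> htpy nb v p q.
Implicit Types (x y z : config d G) (i v : 'rV[int]_d).

(** Composition with [fold] leaves a configuration unchanged near the row through the origin and
    makes it constant on hyperplanes near the row through [hv]. Going along [hv] and [e0 *+ n] in
    both orders relates the two rows through [V]; [rowc_trivial] handles the second. *)
Lemma row_coboundary : exists (b : config d G -> H) (h : nat -> H) (n0 R : nat),
  radius b R /\ forall n x, (n0 <= n)%N -> graph_hom x ->
    (b (shift (e0 *+ n) x) * c (e0 *+ n) x = h n * b x)%g.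
Proof.
have [N0 r0] := cR e0; have [N1 r1] := cR (unitv k1 - e0).
pose N := maxn N0 N1.
have {}r0 : radius (c e0) N by apply: radiusW r0; exact: leq_maxl.
have {}r1 : radius (c (unitv k1 - e0)) N by apply: radiusW r1; exact: leq_maxr.
have [M hM] := connecting_walks edge_nb mixing.
have [b [h [n0 [b_loc bP]]]] := rowc_trivial cM r0
  (rowc_ends cM k01 r0 r1 edge_nb same_parity_htpy) hM.
(* The coordinates of [hv] other than [k0] are [N + N], so [fold_far] applies on its box of size
   [N]; [C] and [w] are the constants in that formula. *)
pose hv : 'rV[int]_d := (N + N)%N%:Z *: (onesv d - e0).
pose C : int := coordsum hv - (d * N)%N%:Z.
pose w : 'rV[int]_d := N%:Z *: onesv d.
pose rowof x : int -> G := fun t => x ((t + C) *: e0 + w).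
pose foldc x : config d G := fun i => x (fold k0 N i).
have fG x : graph_hom x -> graph_hom (foldc x) by exact: fold_hom.
have rowG x : graph_hom x -> biwalk (rowof x).
  move=> /graph_homP xG t; rewrite /rowof.
  have -> : (t + 1 + C) *: e0 + w = (t + C) *: e0 + w + e0.
    by rewrite addrAC scalerDl scale1r addrAC.
  exact: xG.
have onesE k : onesv d 0 k = 1.
  rewrite /onesv summxE (bigD1 k) //= big1 ?addr0 => [|l lk].
    by rewrite unitvE eqxx.
  by rewrite unitvE eq_sym (negPf lk).
have hvE k : k != k0 -> hv 0 k = (N + N)%N%:Z.
  by move=> kk0; rewrite !rVE onesE (negPf kk0) subr0 mulr1.
pose V x := c hv (foldc x).
exists (fun x => b (rowof x) * V x)%g, h, n0.
have [RV hRV] := cR hv; have [Rw hRw] := exists_inbox w.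
exists ((RV + d * RV) + (d * N + `|C| + Rw))%N; split.
  move=> x y xG yG xy; congr (_ * _)%g.
    apply: b_loc; try exact: rowG.
    move=> t tL; apply: xy; apply: (@inboxW _ (d * N + `|C| + Rw)).
      exact: leq_addl.
    apply: inboxD => // k; rewrite !rVE.
    by case: (k == k0); lia.
  apply: hRV; try exact: fG.
  move=> i iR; apply: xy; apply: (@inboxW _ (RV + d * RV)); first exact: leq_addr.
  exact: inbox_fold.
move=> n x n0n xG.
have rowS : rowof (shift (e0 *+ n) x) = shiftw n%:Z (rowof x).
  apply/funext => t; rewrite /rowof /shift /shiftw addrA; congr (x (_ + w)).
  by rewrite -scaler_nat -scalerDl natz; congr (_ *: _); lia.
have foldS : foldc (shift (e0 *+ n) x) = shift (e0 *+ n) (foldc x).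
  by apply/funext => i; rewrite /foldc /shift foldD.
have cE : c (e0 *+ n) (foldc x) = c (e0 *+ n) x.
  apply: (cocycle_line cM r0) => //; first exact: fG.
  move=> i t tn iN; rewrite /foldc foldD fold_id // => k _.
  by have := iN k; lia.
have cF : c (e0 *+ n) (shift hv (foldc x)) = rowc c k0 n (rowof x).
  apply: (cocycle_line cM r0).
  - exact/shift_hom/fG.
  - exact/diag_hom/rowG.
  - move=> i t tn iN; rewrite /shift /foldc fold_far => [|k kk0].
      rewrite /rowof /diag; congr (x (_ *: _ + _)).
      by rewrite coordsumD /C; lia.
    by have := iN k; rewrite rVD hvE // !rVE (negPf kk0) mul0r add0r; lia.
have := cM hv (e0 *+ n) (fG x xG).
rewrite addrC cM ?cF ?cE; last exact: fG.
rewrite -foldS -/(V x) -/(V _) => E.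
by rewrite -mulgA -E rowS mulgA bP ?mulgA //; apply: rowG.
Qed.

(** The modified cocycle equals [h n] along long multiples of [e0]; mixing spreads constancy to all
    unit vectors, and the cocycle identity to the whole lattice. *)
Lemma cocycle_coboundary_constant :
  exists (b : config d G -> H) (R : nat), radius b R /\
  forall m x y, graph_hom x -> graph_hom y ->
  (b (shift m x) * c m x * (b x)^-1 = b (shift m y) * c m y * (b y)^-1)%g.
Proof.
have [b [h [n0 [R [bR bP]]]]] := row_coboundary.
exists b, R; split=> //.
pose c' m x := (b (shift m x) * c m x * (b x)^-1)%g.
have c'M m n x : graph_hom x -> c' (m + n) x = (c' m (shift n x) * c' n x)%g.
  by move=> xG; rewrite /c' cM // shiftD !mulgA mulgVK.
have c'h n x : (n0 <= n)%N -> graph_hom x -> c' (e0 *+ n) x = h n.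
  by move=> n0n xG; rewrite /c' bP // mulgK.
have c'R m : exists N, radius (c' m) N.
  have [N cN] := cR m; have [Rm mR] := exists_inbox m.
  exists (N + (Rm + R))%N => x y xG yG xy; rewrite /c'.
  have xyR : agree (Rm + R) x y by apply: agreeW xy; exact: leq_addl.
  congr (_ * _ * _^-1)%g.
  - apply: bR; [exact: shift_hom|exact: shift_hom|].
    exact: agree_shift mR xyR.
  - by apply: cN => //; apply: agreeW xy; exact: leq_addr.
  - by apply: bR => //; apply: agreeW xyR; exact: leq_addl.
have c'1 k x y : graph_hom x -> graph_hom y -> c' (unitv k) x = c' (unitv k) y.
  have [N cN] := c'R (unitv k).
  (* [h n] conjugates the value at any point to the value at any other. *)
  have twist x0 y0 : graph_hom x0 -> graph_hom y0 -> exists n1, forall n,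
      (n1 <= n)%N -> (c' (unitv k) y0 * h n = h n * c' (unitv k) x0)%g.
    move=> xG yG; have [M hM] := mixing N xG yG.
    exists (maxn M n0) => n; rewrite geq_max => /andP[/hM[z [zG zx zy]] n0n].
    rewrite -(cN _ _ zG xG zx) -(cN _ _ (shift_hom _ zG) yG zy).
    rewrite -(c'h n z n0n zG) -c'M //.
    rewrite (c'h n z n0n zG) -(c'h n _ n0n (shift_hom (unitv k) zG)).
    by rewrite -c'M // addrC.
  (* Both instances have the right-hand side [h n * c' (unitv k) x], so their left-hand sides agree
     and [h n] cancels. *)
  move=> xG yG; have [n1 h1] := twist x x xG xG; have [n2 h2] := twist x y xG yG.
  have := h2 _ (leq_maxr n1 n2); rewrite -h1 ?leq_maxl // => /mulIg.
  by [].
suff: forall m x y, graph_hom x -> graph_hom y -> c' m x = c' m y by [].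
elim/lattice_ind => [|i k IH|i k IH] x y xG yG.
- rewrite /c' !shift0 !(cocycle0 cM) //.
  by rewrite !mulg1 !mulgV.
- rewrite !c'M // (c'1 k x y) //; congr (_ * _)%g.
  by apply: IH; apply: shift_hom.
- have back z : graph_hom z -> exists2 z', graph_hom z' & shift (unitv k) z' = z.
    move=> zG; exists (shift (- unitv k) z); first exact: shift_hom.
    by rewrite shiftD subrr shift0.
  have [x' x'G <-] := back x xG; have [y' y'G <-] := back y yG.
  have cE z : graph_hom z ->
      c' i z = (c' (i - unitv k) (shift (unitv k) z) * c' (unitv k) z)%g.
    by move=> zG; rewrite -c'M // subrK.
  by have := IH x' y' x'G y'G; rewrite !cE // (c'1 k x' y') // => /mulIg.
Qed.

End Trivialization.
(** * Continuity and compactness *)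

Section Topology.
Local Open Scope classical_set_scope.
Variables (d : nat) (G : ugraph).
Implicit Types (x y : config d G) (z : point_of (homshift d G)).
Local Notation X := (homshift d G).

Lemma agreeC R x y : agree R x y -> agree R y x.
Proof. by move=> xy i /xy. Qed.

Lemma agree_trans R x y w : agree R x y -> agree R y w -> agree R x w.
Proof. by move=> xy yw i iR; rewrite xy // yw. Qed.

(** [pos] enumerates the box, so a finite intersection of neighbourhoods suffices. *)
Lemma nbhs_agree x R : nbhs x [set y | agree R x y].
Proof.
pose pos (f : {ffun 'I_d -> 'I_(R + R).+1}) : 'rV[int]_d :=
  (\row_k ((f k)%:Z - R%:Z))%R.
have := filter_forall (nbhs_filter x) (fun f => nbhs_config_at x (pos f)).
apply: filterS => y xy i iR.
suff [f <-] : exists f, pos f = i by rewrite xy.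
exists [ffun k => inord (absz (i 0%R k + R%:Z)%R)].
apply/rowP => k; rewrite mxE ffunE inordK; have := iR k; lia.
Qed.

(** The sets containing a cylinder around [x] form a filter that converges to [x] in each
    coordinate, hence in the product topology. *)
Lemma nbhs_config_agree x (A : set (config d G)) :
  nbhs x A -> exists R, forall y, agree R x y -> A y.
Proof.
pose F : set_system (config d G) :=
  [set B | exists R, forall y, agree R x y -> B y].
have FF : Filter F.
  split=> [|B C [R RB] [R' RC]|B C BC [R RB]]; first by exists 0.
  - exists (maxn R R') => y xy; split.
      by apply: RB; apply: agreeW xy; exact: leq_maxl.
    by apply: RC; apply: agreeW xy; exact: leq_maxr.
  - by exists R => y /RB/BC.
suff : F --> x by apply.
apply/cvg_sup => i B /= [_ /= [[W oW <-] Wx WB]].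
have [R iR] := exists_inbox i.
exists R => y xy; apply: WB => /=.
by rewrite /= -(xy i iR).
Qed.

Lemma nbhs_point_agree z R :
  nbhs z [set z' | agree R (val z) (val z')].
Proof. exact: (@initial_continuous _ _ val z _ (nbhs_agree (val z) R)).
Qed.

Lemma nbhs_pointP z (A : set (point_of X)) :
  nbhs z A <-> exists R, forall z', agree R (val z) (val z') -> A z'.
Proof.
split=> [|[R RA]]; last by apply: filterS (nbhs_point_agree z R).
move=> [_ /= [[W oW <-] /= Wz WA]].
have /nbhs_config_agree[R RW] : nbhs (val z) W by apply: open_nbhs_nbhs.
by exists R => z' /RW; apply: WA.
Qed.

Lemma continuous_discreteP (H : groupType) (f : point_of X -> H) :
  continuous (f : point_of X -> discrete_topology H) <->
  forall z, exists R, forall z',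
    agree R (val z) (val z') -> f z' = f z.
Proof.
split=> [fc z|fl z].
  have fz : nbhs z (f @^-1` [set f z]).
    exact: fc z _ (discrete_set1 (f z : discrete_topology H)).
  by have [R fR] := (nbhs_pointP _ _).1 fz; exists R.
have fz : nbhs z (f @^-1` [set f z]) by apply/nbhs_pointP; apply: fl.
move=> B /principal_filterP Bfz; apply: filterS fz => z' /= ->.
exact: Bfz.
Qed.

Lemma compact_graph_hom : compact (@graph_hom d G).
Proof.
apply: (@subclosed_compact _ _ setT) => //; first exact: graph_hom_closed.
have := @tychonoff 'rV[int]_d (fun=> discrete_topology G) (fun=> setT).
have -> : [set f : config d G | forall i, setT (f i)] = setT.
  by apply/seteqP; split.
by apply=> i; apply: finite_compact; exact: (@finite_finset G).
Qed.

Definition hom_point x (xG : graph_hom x) : point_of X := SigSub (mem_set xG).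

Lemma val_hom z : graph_hom (val z).
Proof. exact: set_valP. Qed.

Lemma hom_pointK z (zG : graph_hom (val z)) : hom_point zG = z.
Proof. exact/val_inj. Qed.

(** Continuity gives a radius at each point, and compactness makes it uniform. *)
Lemma point_radius (H : groupType) (f : point_of X -> H) :
  continuous (f : point_of X -> discrete_topology H) ->
  exists N, forall z z', agree N (val z) (val z') -> f z = f z'.
Proof.
move/continuous_discreteP => fl.
pose P N x := forall z z', val z = x -> agree N x (val z') -> f z = f z'.
have /compact_near_coveringP/(_ nat \oo P _)[x xG|N _ NP] := compact_graph_hom.
  have [R fR] := fl (hom_point xG).
  exists ([set y | agree R x y], [set N | (R <= N)%N]) => /=.
    by split; [exact: nbhs_agree|exists R].
  move=> [y N] /= [xy RN] z z' zy yz'.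
  rewrite (fR z) ?zy // (fR z') //=.
  by apply: agree_trans xy _; apply: agreeW yz'.
by exists N => z z' /NP; apply=> //; [exact: leqnn|exact: val_hom].
Qed.

(** Mixing yields [act n z] in the first open set with [z] in the second, so the cylinder around [y]
    has to come first. *)
Lemma mixing_agree k x y R : topologically_mixing X ->
  graph_hom x -> graph_hom y -> exists M, forall n, (M <= n)%N ->
  exists w, [/\ graph_hom w, agree R w x & agree R (shift (unitv k *+ n)%R w) y].
Proof.
move=> [_ mix] xG yG.
pose cyl z : set (point_of X) :=
  interior [set z' : point_of X | agree R (val z) (val z')].
have cyl0 z : cyl z !=set0 by exists z; apply: nbhs_point_agree.
have [M hM] := mix (cyl (hom_point yG)) (cyl (hom_point xG))
  (open_interior _) (open_interior _) (cyl0 _) (cyl0 _).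
exists M => n Mn; have := hM (unitv k *+ n)%R; rewrite l1norm_unitv => /(_ Mn).
move=> [w [/interior_subset yz] [z /interior_subset xz zE]].
exists (val z); split; first exact: val_hom.
- exact: agreeC xz.
- by move: yz; rewrite -zE /= => /agreeC.
Qed.

Lemma homshift_cohomologically_trivial (k0 k1 : 'I_d) (nb : G -> G) :
  k0 != k1 -> (forall v, edge v (nb v)) ->
  (forall (u v : G) p q, walk u v p -> walk u v q ->
     odd (size p) = odd (size q) -> htpy nb v p q) ->
  topologically_mixing X -> cohomologically_trivial X.
Proof.
move=> k01 edge_nb par mix H c [cM cC].
(* The algebraic part uses total functions on configurations; the value [1] outside the homshift is
   a dummy. *)
pose c' m x : H :=
  if pselect (graph_hom x) is left xG then c m (hom_point xG) else 1%g.
have c'E m z : c' m (val z) = c m z.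
  rewrite /c'; case: pselect => [zG|]; first by rewrite hom_pointK.
  by case; apply: val_hom.
have actE m z : val (act m z) = shift m (val z) by [].
have c'P m x (xG : graph_hom x) : c' m x = c m (hom_point xG).
  by rewrite -c'E.
have c'M (m n : 'rV[int]_d) x : graph_hom x ->
    c' (m + n)%R x = (c' m (shift n x) * c' n x)%g.
  by move=> xG; rewrite -[x]/(val (hom_point xG)) -actE !c'E.
have c'R m : exists N, radius (c' m) N.
  have [N cN] := point_radius (cC m).
  exists N => x y xG yG xy.
  by rewrite (c'P _ _ xG) (c'P _ _ yG); apply: cN.
have [b [R [bR bP]]] := cocycle_coboundary_constant c'M c'R k01
  (fun x y R => @mixing_agree k0 x y R mix) edge_nb par.
have bc : continuous
    ((fun z : point_of X => b (val z)) : point_of X -> discrete_topology H).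
  apply/continuous_discreteP => z; exists R => z' zz'.
  by apply/esym/bR => //; apply: val_hom.
exists (fun m z => b (val (act m z)) * c m z * (b (val z))^-1)%g.
  split=> [m n z|n z z'].
    rewrite cM !mulgA mulgVK.
    congr (b _ * _ * _ * _)%g; rewrite !actE /=.
    by rewrite shiftD.
  rewrite -!c'E !actE; apply: bP; exact: val_hom.
exists (fun z => b (val z)) => // n z.
by rewrite !mulgA mulVg mul1g mulgVK.
Qed.

End Topology.
(** * The square group *)

Section SquareGroup.
Variables (G : ugraph) (a : G).
Local Open Scope group_scope.
Local Open Scope quotient_scope.
Implicit Types (g h : pi1 a) (x y z w : G) (p q s : seq G).

Local Notation S := (square_group a).
Local Notation proj := (\pi_(quotient_group (Delta a))).

Lemma projP g h : reflect (normal_set (Delta a) (g^-1 * h)) (proj g == proj h).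
Proof. exact: quotient_eqP. Qed.

Lemma projM g h : proj (g * h) = proj g * proj h :> S.
Proof. exact: pi_quotient_mul. Qed.

Lemma proj1 : proj 1 = 1 :> S.
Proof. by []. Qed.

Lemma proj_eq1 g : proj g = 1 :> S <-> normal_set (Delta a) g.
Proof.
split=> [/eqP|gD].
  by rewrite eq_sym -proj1 => /projP; rewrite invg1 mul1g.
by apply/eqP; rewrite eq_sym -proj1; apply/projP; rewrite invg1 mul1g.
Qed.

Lemma even_square_trivialP : trivial_group (even_square_group a) <->
  forall g, g \in @even_pred G a -> normal_set (Delta a) g.
Proof.
split=> [tr g ge|eD x].
  have /esym/eqP/quotient_eqP := tr (\pi_(quotient_group (even_Delta a)) (EvenPi1 ge)).
  by rewrite invg1 mul1g.
rewrite -[x]reprK; apply/eqP; rewrite eq_sym; apply/quotient_eqP.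
by rewrite invg1 mul1g; apply: eD; case: (repr x).
Qed.

Lemma evenM g h :
  (g * h \in @even_pred G a) = ((g \in @even_pred G a) == (h \in @even_pred G a)).
Proof.
rewrite !unfold_in /= (odd_walk_length_star (pi1_isWalk g) (pi1_isWalk h)).
by case: (odd _); case: (odd _).
Qed.

Lemma evenV g : (g^-1 \in @even_pred G a) = (g \in @even_pred G a).
Proof. by rewrite !unfold_in /= /walk_length size_rev. Qed.

Lemma even1 : (1 : pi1 a) \in @even_pred G a.
Proof. by []. Qed.

Variable o : pi1 a.
Hypothesis odd_o : o \notin @even_pred G a.

(** As [Delta a] contains only even cycles, no even cycle has the class of [o]; in a group of order
    two this leaves a single class, that of [1]. *)
Lemma Z2_even_trivial : isomorphic S 'Z_2 ->
  forall g, g \in @even_pred G a -> normal_set (Delta a) g.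
Proof.
move=> [f /bij_inj f_inj] g ge; apply/proj_eq1/f_inj.
have fo h : h \in @even_pred G a -> f (proj h) != f (proj o).
  move=> he; apply/eqP => /f_inj/eqP/projP/Delta_even.
  by rewrite evenM evenV he (negPf odd_o).
have := fo g ge; have := fo 1 even1; rewrite proj1.
move: (f _) (f _) (f _) => [[|[|[]]] // i] [[|[|[]]] // j] [[|[|[]]] // k] //=;
  by move=> *; apply/val_inj.
Qed.

(** The isomorphism is the parity of a representative, well defined by [Delta_even] and injective
    because even cycles lie in [Delta a]. *)
Lemma even_trivial_Z2 :
  (forall g, g \in @even_pred G a -> normal_set (Delta a) g) ->
  isomorphic S 'Z_2.
Proof.
move=> eD.
pose par (u : S) : 'Z_2 := if repr u \in @even_pred G a then 0%R else 1%R.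
have parE g : par (proj g) = if g \in @even_pred G a then 0%R else 1%R.
  rewrite /par; set h := repr _.
  have /Delta_even : normal_set (Delta a) (g^-1 * h) by apply/projP; rewrite reprK.
  by rewrite evenM evenV => /eqP->.
have parM : {morph par : u v / u * v}.
  move=> u v; rewrite -[u]reprK -[v]reprK -projM !parE evenM.
  by do 2![case: (_ \in _)]; apply/val_inj.
pose P := isMultiplicative.Build S 'Z_2 par parM.
pose f : {multiplicative S -> 'Z_2} := HB.pack par P.
exists f; exists (fun t : 'Z_2 => if t == 0%R then 1 else proj o).
- move=> u; rewrite /= -[u]reprK parE; have [ue|ue] := boolP (repr u \in @even_pred G a).
    by rewrite eqxx; apply: esym; apply: (proj_eq1 _).2; apply: eD.
  apply/eqP/(projP o); apply: eD.
  by rewrite evenM evenV (negPf odd_o) (negPf ue).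
- move=> t /=; case: eqP => [->|t0]; first by rewrite -proj1 parE even1.
  rewrite parE (negPf odd_o).
  case: t t0 => [[|[|[]]] // i] t0; last exact/val_inj.
  by case: t0; apply/val_inj.
Qed.

End SquareGroup.
(** * The cocycle of walk classes *)

Section FlatConnection.
Local Open Scope ring_scope.

Lemma int_recursion (H : groupType) (B : int -> H) :
  exists P : int -> H, forall t, P (t + 1) = (B t * P t)%g.
Proof.
(* [up n] and [down n] are the values at [n] and [- n]; downwards the recursion is solved for
   [P t]. *)
pose up n := nat_rect (fun=> H) 1%g (fun m h => (B m%:Z * h)%g) n.
pose down n := nat_rect (fun=> H) 1%g
  (fun m h => ((B (- m.+1%:Z))^-1 * h)%g) n.
exists (fun t => if 0 <= t then up `|t|%N else down `|t|%N) => t.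
have [t0|t0] := leP 0 t.
  rewrite ifT; last by lia.
  have -> : absz (t + 1) = (absz t).+1 by lia.
  by rewrite /=; congr (B _ * _)%g; lia.
have tE : absz t = (absz (t + 1)).+1 by lia.
have -> : down (absz t) = ((B t)^-1 * down (absz (t + 1)))%g.
  by rewrite {1}tE /=; congr ((B _)^-1 * _)%g; lia.
rewrite mulVKg; case: ifP => // t1.
by have -> : absz (t + 1) = 0%N by lia.
Qed.

Variables (d : nat) (H : groupType).
Implicit Types (i : 'rV[int]_d) (k l : 'I_d).

(* One direction at a time: after a gauge change that makes [A] trivial in the
   first [m] directions, [A] in direction [m] no longer depends on the first [m]
   coordinates, and is integrated along lines. *)
Lemma flat_potential (A : 'I_d -> 'rV[int]_d -> H) :
  (forall k l i, A k (i + unitv l) * A l i = A l (i + unitv k) * A k i)%g ->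
  exists phi : 'rV[int]_d -> H, forall k i, phi (i + unitv k) = (A k i * phi i)%g.
Proof.
move=> flat.
suff /(_ d (leqnn d)) [phi phiP] : forall m, (m <= d)%N ->
    exists phi : 'rV[int]_d -> H,
      forall k i, (k < m)%N -> phi (i + unitv k) = (A k i * phi i)%g.
  by exists phi => k i; apply: phiP.
elim=> [|m IHm] md; first by exists (fun=> 1%g).
have [phi phiP] := IHm (ltnW md).
pose km := Ordinal md.
pose A' i := ((phi (i + unitv km))^-1 * A km i * phi i)%g.
have A'S l i : (l < m)%N -> A' (i + unitv l) = A' i.
  move=> lm; rewrite /A' addrAC !(phiP l) // invgM -!mulgA; congr (_ * _)%g.
  by rewrite !mulgA -[(_^-1 * A km _ * _)%g]mulgA flat mulKg.
(* Parametrizing by the coordinate [km] itself makes [line] the same function at all points of a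
   line in direction [km], so one solution [P] serves them all. *)
pose line i : int -> H := fun t => A' (i + (t - i 0 km) *: unitv km).
have [P PP] := choice (@int_recursion H).
pose psi i := P (line i) (i 0 km).
have psi_m i : psi (i + unitv km) = (A' i * psi i)%g.
  rewrite /psi (_ : line (i + unitv km) = line i).
    by rewrite !rVE eqxx PP /line subrr scale0r addr0.
  apply/funext => t; rewrite /line; congr A'.
  by apply/rowP => k; rewrite !rVE eqxx (_ : true%:Z = 1) //; ring.
have psi_l l i : (l < m)%N -> psi (i + unitv l) = psi i.
  move=> lm; have kml : (km == l) = false.
    by apply/eqP => kml; move: lm; rewrite -kml ltnn.
  rewrite /psi !rVE kml addr0; congr (P _ _).
  apply/funext => t; rewrite /line !rVE kml addr0.
  by rewrite addrAC A'S.
exists (fun i => phi i * psi i)%g => k i; rewrite ltnS leq_eqVlt.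
case/orP=> [/eqP km'|km'].
  have -> : k = km by apply/val_inj.
  by rewrite psi_m /A' !mulgA mulgV mul1g.
by rewrite phiP // psi_l // mulgA.
Qed.

End FlatConnection.

(** * Classes of walks in the square group *)

Section WalkCocycle.
Variables (d : nat) (G : ugraph) (a : G).
Hypothesis conn : graph_connected G.
Local Open Scope group_scope.
Local Open Scope quotient_scope.
Implicit Types (g h : pi1 a) (x y w : G) (p q s : seq G).

Local Notation S := (square_group a).
Local Notation proj := (\pi_(quotient_group (Delta a))).

Lemma star_reduce_right x y z p q : walk x y p -> walk y z q ->
  star p (reduce q) = star p q.
Proof.
move=> /walkP[p' [-> _ lp]] /walkP[q' [-> _ _]].
by rewrite lastI lp star_reducer.
Qed.

Lemma star_reduce_left x y z p q : walk x y p -> walk y z q ->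
  star (reduce p) q = star p q.
Proof.
move=> /walkP[p' [-> _ lp]] /walkP[q' [-> _ _]].
by rewrite lastI lp star_reducel.
Qed.

(** The trivial walk at [a] ensures that closing up a reduced cycle at [a] leaves it unchanged. *)
Lemma exists_base_walks : exists T : G -> seq G,
  (forall x, walk a x (T x)) /\ T a = [:: a].
Proof.
have /choice[T TP] : forall x, exists p, walk a x p /\ (x = a -> p = [:: a]).
  move=> x; have [->|xa] := eqVneq x a.
    by exists [:: a]; split=> //; exact: walk1.
  have [p wp] := connected_walk conn a x.
  by exists p; split=> // xa'; case/eqP: xa.
by exists T; split=> [x|]; [case: (TP x)|case: (TP a) => _; apply].
Qed.

Variable T : G -> seq G.
Hypothesis T_walk : forall x, walk a x (T x).
Hypothesis T_base : T a = [:: a].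

Definition closeup x y p : seq G := star (star (T x) p) (rev (T y)).

Definition cls x y p : S := proj (insubd (1 : pi1 a) (closeup x y p)).

Lemma val_closeup x y p : walk x y p ->
  val (insubd (1 : pi1 a) (closeup x y p)) = closeup x y p.
Proof.
move=> wp; apply: insubdK; rewrite unfold_in /reduced_cycle.
rewrite (walk_star (walk_star (T_walk x) wp) (walk_rev (T_walk y))).
exact: reduce_nonbacktracking.
Qed.

Lemma cls_reduce x y p : walk x y p -> cls x y (reduce p) = cls x y p.
Proof.
by move=> wp; rewrite /cls /closeup (star_reduce_right (T_walk x) wp).
Qed.

(** The return along [T y] after [p] cancels against the outward [T y] before [q]. *)
Lemma cls_star x y z p q : walk x y p -> walk y z q ->
  cls x z (star p q) = cls x y p * cls y z q.
Proof.
move=> wp wq; rewrite /cls -projM; congr (proj _); apply/val_inj.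
rewrite val_closeup ?(walk_star wp wq) //=.
rewrite !val_closeup // /closeup.
have wx := T_walk x; have wy := T_walk y; have wz := T_walk z.
have wy' := walk_rev wy; have wz' := walk_rev wz.
have wxp := walk_star wx wp; have wyq := walk_star wy wq.
rewrite -(starA wxp wy' (walk_star wyq wz')) (starA wy' wyq wz').
rewrite (starA wy' wy wq) (star_revl wy).
have -> : star [:: y] q = reduce q by case/walkP: wq => q' [-> _ _].
rewrite (star_reduce_left wq wz') (starA wxp wq wz').
by rewrite (starA wx wp wq).
Qed.

Lemma cls_odot x y z p q : walk x y p -> walk y z q ->
  cls x z (odot p q) = cls x y p * cls y z q.
Proof.
by move=> wp wq; rewrite -cls_star // -(cls_reduce (walk_odot wp wq)).
Qed.

Lemma cls1 x : cls x x [:: x] = 1.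
Proof.
have w1 := walk1 x; have := cls_star w1 w1; rewrite (_ : star _ _ = [:: x]) //.
by move/(congr1 (fun u => (cls x x [:: x])^-1 * u)); rewrite mulVg mulKg.
Qed.

Lemma cls_square x s : square x s -> cls x x s = 1.
Proof.
move=> sq; have ws : walk x x s by case/and3P: sq.
apply/proj_eq1; move=> M [_]; apply.
exists x, (T x), s; split=> //.
by rewrite val_closeup.
Qed.

Definition lab x y : S := cls x y [:: x; y].

Lemma walk2 x y : edge x y -> walk x y [:: x; y].
Proof. by move=> xy; rewrite /= xy !eqxx. Qed.

Lemma lab_inv x y : edge x y -> lab x y * lab y x = 1.
Proof.
move=> xy; have yx : edge y x by rewrite edge_sym.
rewrite /lab -(cls_star (walk2 xy) (walk2 yx)) -(cls1 x); congr cls.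
by rewrite /star /odot /= eqxx.
Qed.

(** If [x = z] both sides are trivial, and if [y = w] they coincide; otherwise [x y z w x] is a
    square, whose class is trivial. This is the flatness that [flat_potential] needs. *)
Lemma lab_flip x y z w : edge x y -> edge y z -> edge x w -> edge w z ->
  lab x y * lab y z = lab x w * lab w z.
Proof.
move=> xy yz xw wz; have [xz|xz] := eqVneq x z.
  by rewrite -xz in yz wz *; rewrite !lab_inv.
have [->//|yw] := eqVneq y w.
have zw : edge z w by rewrite edge_sym.
have wx : edge w x by rewrite edge_sym.
have sq : square x [:: x; y; z; w; x].
  by rewrite /square /= xy yz zw wx !eqxx xz yw eq_sym xz.
have w1 := walk_odot (walk2 xy) (walk2 yz).
have w2 := walk_odot (walk2 zw) (walk2 wx).
have := cls_odot w1 w2; rewrite [odot _ _]/= (cls_square sq).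
rewrite (cls_odot (walk2 xy) (walk2 yz)) (cls_odot (walk2 zw) (walk2 wx)).
rewrite -!/(lab _ _) => E; apply: (mulIg (lab z w * lab w x)); rewrite -E.
by rewrite -mulgA [lab w z * _]mulgA lab_inv // mul1g lab_inv.
Qed.

Lemma cls_cycle g : cls a a (pi1_walk g) = 1 -> normal_set (Delta a) g.
Proof.
move=> /proj_eq1; congr normal_set; apply/val_inj; rewrite val_closeup.
  rewrite /closeup T_base (star1 (pi1_isWalk g) (pi1_nonbacktracking g)).
  exact/starr1/pi1_nonbacktracking.
exact: pi1_isWalk.
Qed.

(* With [c (m + n) z = c m (act n z) * c n z] and products of walks read from
   left to right, [c n z] has to be the class of a walk from [z n] to [z 0]. *)
Lemma walk_cocycle : exists c : 'rV[int]_d -> point_of (homshift d G) -> S,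
  continuous_cocycle c /\
  forall k i z, c (i + unitv k)%R z =
    lab (val z (i + unitv k)%R) (val z i) * c i z.
Proof.
have stepE (z : point_of (homshift d G)) k i :
    edge (val z (i + unitv k)%R) (val z i).
  by rewrite edge_sym; have /graph_homP := val_hom z; apply.
have ex (z : point_of (homshift d G)) : exists phi : 'rV[int]_d -> S,
    phi 0%R = 1 /\ forall k i, phi (i + unitv k)%R =
      lab (val z (i + unitv k)%R) (val z i) * phi i.
  have [|phi phiP] := @flat_potential d S
    (fun k i => lab (val z (i + unitv k)%R) (val z i)).
    move=> k l i; rewrite [(i + unitv k + _)%R]addrAC; apply: lab_flip => //.
    by rewrite addrAC.
  exists (fun i => phi i * (phi 0%R)^-1); split; first by rewrite mulgV.
  by move=> k i; rewrite phiP mulgA.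
have [c cP] := choice ex; exists (fun i z => c z i); split; last first.
  by move=> k i z; case: (cP z).
have c0 z : c z 0%R = 1 by case: (cP z).
have cS z k i : c z (i + unitv k)%R =
    lab (val z (i + unitv k)%R) (val z i) * c z i by case: (cP z).
have cB z k i : c z (i - unitv k)%R =
    (lab (val z i) (val z (i - unitv k)%R))^-1 * c z i.
  by have := cS z k (i - unitv k)%R; rewrite subrK => ->; rewrite mulKg.
split=> [m n z|n]; last first.
  apply/continuous_discreteP.
  suff [R cR] : exists R, forall z z' : point_of (homshift d G),
      agree R (val z) (val z') -> c z' n = c z n.
    by move=> z; exists R => z'; apply: cR.
  have inb (i k : 'rV[int]_d) : exists R, inbox R i /\ inbox R k.
    have [R iR] := exists_inbox i; have [R' kR] := exists_inbox k.
    exists (maxn R R'); split.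
      by apply: inboxW iR; exact: leq_maxl.
    by apply: inboxW kR; exact: leq_maxr.
  elim/lattice_ind: n => [|i k [R IH]|i k [R IH]]; first by
    exists 0 => z z'; rewrite !c0.
  - have [R' [iR jR]] := inb i (i + unitv k)%R.
    exists (maxn R R') => z z' zz'; rewrite !cS.
    rewrite (IH z z'); last by apply: agreeW zz'; exact: leq_maxl.
    have {}zz' : agree R' (val z) (val z') by apply: agreeW zz'; exact: leq_maxr.
    by rewrite !(zz' _ iR) !(zz' _ jR).
  - have [R' [iR jR]] := inb i (i - unitv k)%R.
    exists (maxn R R') => z z' zz'; rewrite !cB.
    rewrite (IH z z'); last by apply: agreeW zz'; exact: leq_maxl.
    have {}zz' : agree R' (val z) (val z') by apply: agreeW zz'; exact: leq_maxr.
    by rewrite !(zz' _ iR) !(zz' _ jR).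
have actE i : val (act n z) i = val z (n + i)%R by [].
elim/lattice_ind: m => [|i k IH|i k IH].
- by rewrite c0 add0r mul1g.
- rewrite (addrAC i) (cS (act n z)) (cS z) IH !actE !addrA.
  by rewrite ![(n + i)%R]addrC mulgA.
- rewrite (addrAC i) (cB (act n z)) (cB z) IH !actE !addrA.
  by rewrite ![(n + i)%R]addrC mulgA.
Qed.

Hypothesis edge_ex : forall v : G, exists w, edge v w.
Variable k0 : 'I_d.

Lemma cohomologically_trivial_even : cohomologically_trivial (homshift d G) ->
  forall g, g \in @even_pred G a -> normal_set (Delta a) g.
Proof.
have [c [cc cS]] := walk_cocycle => triv g ge; have [cM _] := cc.
have [c' [c'M c'const] [b _ bP]] := triv _ _ cc.
have [nb nbP] := choice edge_ex.
have e2 : edge (nb a) a by rewrite edge_sym nbP.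
have c0 z : c 0%R z = 1.
  have a0 : act 0%R z = z.
    by apply/val_inj/funext => i; rewrite /= /shift add0r.
  have := cM 0%R 0%R z; rewrite addr0 a0.
  by move/(congr1 (fun u => (c 0%R z)^-1 * u)); rewrite mulVg mulKg => <-.
(* At a periodic point both values of [b] are equal, so [c] is conjugate to [c'] there. *)
have per n z : act (unitv k0 *+ n)%R z = z ->
    c (unitv k0 *+ n)%R z = (b z)^-1 * c' (unitv k0 *+ n)%R z * b z.
  by move=> zn; rewrite bP zn.
(* The cocycle reads the walk backwards, from time [n] to [0], which gives the inverse class. *)
have cw r (rw : biwalk r) n :
    cls (r 0%R) (r (Posz n)) (mkseq (fun j => r (Posz j)) n.+1)
    * c (unitv k0 *+ n)%R (hom_point (diag_hom d rw)) = 1.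
  elim: n => [|n IHn]; first by rewrite c0 mulg1 cls1.
  rewrite mulrSr cS /= /diag !coordsumD coordsumMn coordsum_unitv natz.
  have rn := rw (Posz n).
  have -> : (Posz n.+1) = ((Posz n) + 1)%R by lia.
  have -> : mkseq (fun j => r (Posz j)) n.+2 =
      odot (mkseq (fun j => r (Posz j)) n.+1) [:: r (Posz n); r ((Posz n) + 1)%R].
    by rewrite [LHS]mkseqS -cats1 /odot; congr (_ ++ [:: r _]); lia.
  have wn : walk (r 0%R) (r (Posz n)) (mkseq (fun j => r (Posz j)) n.+1).
    have := walk_mkseq 0%R n rw; rewrite add0r.
    by rewrite (eq_mkseq (fun j => congr1 r (add0r (Posz j)))).
  rewrite (cls_odot wn (walk2 rn)) -/(lab _ _) mulgA -[_ * lab _ _ * lab _ _]mulgA.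
  by rewrite lab_inv // mulg1.
have diag_per r (rw : biwalk r) n : shiftw (Posz n) r = r ->
    act (unitv k0 *+ n)%R (hom_point (diag_hom d rw)) = hom_point (diag_hom d rw).
  move=> rn; apply/val_inj; rewrite [LHS]/=.
  by rewrite shift_diag coordsumMn coordsum_unitv natz rn.
(* On the checkerboard of [a] and [nb a], of period two, [c] is the inverse class of a backtrack,
   hence trivial; constancy of [c'] carries this to every [z]. *)
have c'2 z : c' (unitv k0 *+ 2)%R z = 1.
  pose r (t : int) := if odd `|t|%N then nb a else a.
  have rw : biwalk r by apply: biwalk_alternating => v; apply: nbP.
  have r2 : shiftw (Posz 2) r = r.
    apply/funext => t; rewrite /r /shiftw.
    by have -> : odd (absz (t + 2)%R) = odd (absz t) by lia.
  have := cw r rw 2%N; rewrite per; last exact: diag_per.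
  rewrite (c'const _ _ z) (_ : cls _ _ _ = 1) ?mul1g; last first.
    rewrite [mkseq _ _]/= /r /=.
    by have := lab_inv (nbP a); rewrite /lab -cls_odot //; exact: walk2.
  move/(congr1 (fun u => b (hom_point (diag_hom d rw)) * u *
    (b (hom_point (diag_hom d rw)))^-1)).
  by rewrite !mulgA mulgV mul1g mulgK mulg1 mulgV.
have c'even n z : c' (unitv k0 *+ n.*2)%R z = 1.
  elim: n => [|n IHn].
    have := c'M 0%R 0%R z; rewrite addr0 (c'const 0%R (act 0%R z) z).
    by move/(congr1 (fun u => (c' 0%R z)^-1 * u)); rewrite mulVg mulKg mulr0n.
  rewrite (_ : n.+1.*2 = n.*2 + 2) ?addn2 // -addn2 mulrnDr c'M c'2 mulg1.
  by rewrite (c'const _ _ z).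
have wg := pi1_isWalk g; set p := pi1_walk g in wg.
have pe : ~~ odd (size p).-1 := ge.
have [n pn] : exists n, size p = n.*2.+1.
  exists (size p).-1./2; case: (p) wg pe => //= x p' _ pe.
  by have := odd_double_half (size p'); rewrite (negPf pe); lia.
(* The periodization of [p] below needs a positive period. *)
have [n0|n0] := posnP n.
  have pa : p = [:: a].
    by case/walkP: wg pn => -[|? ?] [-> _ _]; rewrite n0.
  by apply: cls_cycle; rewrite -/p pa cls1.
pose r (t : int) := nth a p (absz (t %% (Posz n.*2))%Z).
have nth0 : nth a p 0 = a by case/walkP: wg => p' [-> _ _].
have nthn : nth a p n.*2 = a.
  case/walkP: wg pn => p' [-> _ lp] [pn].
  by rewrite -pn nth_last /= -[in RHS]lp; case: (p').
have rw : biwalk r.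
  move=> t; rewrite /r.
  have m0 : (0 < (Posz n.*2))%R by lia.
  set u := absz (t %% (Posz n.*2))%Z.
  have u0 := modz_ge0 t (lt0r_neq0 m0).
  have un : (u < n.*2)%N by rewrite /u; have := ltz_pmod t m0; move: u0; lia.
  have uE : ((t %% (Posz n.*2))%Z = (Posz u))%R by rewrite /u; move: u0; lia.
  have edge_u : edge (nth a p u) (nth a p u.+1).
    case/walkP: wg pn => p' [-> pP _] [pn] /=.
    by apply: (pathP a pP); rewrite pn.
  rewrite -modzDml uE; have [un1|un1] := ltnP u.+1 n.*2.
    by rewrite modz_small //; [rewrite (_ : absz _ = u.+1) //; lia|lia].
  have un2 : u.+1 = n.*2 by lia.
  rewrite (_ : ((Posz u) + 1)%R = (Posz n.*2)); last by lia.
  by move: edge_u; rewrite un2 nthn modzz [nth a p (absz _)]nth0.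
have r_per : shiftw (Posz n.*2) r = r.
  by apply/funext => t; rewrite /r /shiftw modzDr.
(* Over one period the walk is [p], and [c'] is trivial at even multiples of [unitv k0], so the
   class of [p] is trivial. *)
have := cw r rw n.*2; rewrite per; last exact: diag_per.
rewrite c'even mulg1 mulVg mulg1.
have -> : r (Posz n.*2) = a by rewrite /r modzz.
have -> : r 0%R = a by rewrite /r mod0z.
have -> : mkseq (fun j => r (Posz j)) n.*2.+1 = p.
  apply: (@eq_from_nth _ a); first by rewrite size_mkseq pn.
  move=> j; rewrite size_mkseq ltnS leq_eqVlt => /predU1P[->|jn].
    by rewrite nth_mkseq // /r modzz nth0 nthn.
  by rewrite nth_mkseq /r ?modz_small //; lia.
exact: cls_cycle.
Qed.

End WalkCocycle.

(** * Edges and odd cycles from mixing, and the equivalences *)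

Lemma mixing_edge d (G : ugraph) (k : 'I_d) : graph_connected G ->
  topologically_mixing (homshift d G) -> forall v : G, exists w, edge v w.
Proof.
move=> conn [[z _] _] v; have /connectP[[|w p] /= vp zv] := conn v (val z 0%R).
  rewrite -zv; exists (val z (0 + unitv k)%R).
  exact: (graph_homP _).2 (val_hom z) _ _.
by exists w; case/andP: vp.
Qed.

Lemma mixing_odd_cycle d (G : ugraph) (k : 'I_d) (a : G) : graph_connected G ->
  topologically_mixing (homshift d G) -> exists o : pi1 a, o \notin @even_pred G a.
Proof.
move=> conn mix; have [nb nbP] := choice (mixing_edge k conn mix).
have [M hM] := connecting_walks nbP (fun x y R => @mixing_agree d G k x y R mix).
(* [M.*2.+1] is an odd length above the threshold [M]. *)
have [|r [rw r0 rn]] := hM M.*2.+1 a a; first by lia.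
have := walk_mkseq 0%R M.*2.+1 rw; rewrite add0r r0 rn.
have := size_mkseq (fun j => r (0 + Posz j)%R) M.*2.+2.
move: (mkseq _ _) => s sM /walk_reduce ws.
have oP : reduced_cycle a (reduce s) by rewrite /reduced_cycle ws reduce_nonbacktracking.
exists (Pi1 oP); rewrite unfold_in negbK -[pi1_walk _]/(reduce s) /walk_length.
have := odd_size_reduce s; rewrite sM.
by case: (reduce s) ws => //= x p _; lia.
Qed.

Theorem theorem1p1 (d : nat) (G : ugraph) (a : G) :
  (1 < d)%N -> graph_connected G -> topologically_mixing (homshift d G) ->
  (cohomologically_trivial (homshift d G) <-> isomorphic (square_group a) 'Z_2)
  /\ (isomorphic (square_group a) 'Z_2 <-> trivial_group (even_square_group a)).
Proof.
move=> d1 conn mix; pose k0 := Ordinal (ltnW d1); pose k1 := Ordinal d1.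
have [nb nbP] := choice (mixing_edge k0 conn mix).
have [o oO] := mixing_odd_cycle k0 a conn mix.
have evenP := even_square_trivialP a.
have [T [TP Ta]] := exists_base_walks a conn.
split; [split=> [triv|iso]|split=> [iso|even_triv]].
- exact: even_trivial_Z2 oO (cohomologically_trivial_even TP Ta
    (mixing_edge k0 conn mix) k0 triv).
- apply: (@homshift_cohomologically_trivial _ _ k0 k1 nb) => //.
  exact: (even_htpy nbP conn (Z2_even_trivial oO iso)).
- exact: evenP.2 (Z2_even_trivial oO iso).
- exact: even_trivial_Z2 oO (evenP.1 even_triv).
Qed.
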